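(* Let $f\in L^\infty(Q)$, $g\in L^2(\Sigma)\cap L^\infty(\Sigma)$ and $\rho_0\in L^\infty(\Omega)$. Then the weak solution $\rho$ of $$\rho_t+(-\Delta)^s\rho=f\ \text{ in } Q,\qquad \mathcal{N}_s\rho+\rho=g\ \text{ in }\Sigma,\qquad \rho(\cdot,0)=\rho_0\ \text{ in }\Omega$$ satisfies $$\rho(x,t)\le e^T\left(\|\rho_0\|_{L^\infty(\Omega)}+\|f\|_{L^\infty(Q)}+\|g\|_{L^\infty(\Sigma)}\right)\quad\text{for a.e. }(x,t)\in\mathbb{R}^N\times[0,T].$$
   Context: Setting: $N\ge 1$, $\Omega\subset\mathbb{R}^N$ is a bounded open domain with Lipschitz continuous boundary, $0<s<1$, $T>0$, $Q=\Omega\times(0,T)$, $\Sigma=(\mathbb{R}^N\setminus\Omega)\times(0,T)$, and $C_{N,s}=\frac{s2^{2s}\Gamma((2s+N)/2)}{\pi^{N/2}\Gamma(1-s)}$. Formally, $(-\Delta)^s w(x)=C_{N,s}\,\mathrm{P.V.}\int_{\mathbb{R}^N}\frac{w(x)-w(y)}{|x-y|^{N+2s}}\,dy$ and the nonlocal normal derivative is $\mathcal{N}_s w(x)=C_{N,s}\int_\Omega\frac{w(x)-w(y)}{|x-y|^{N+2s}}\,dy$ for $x\in\mathbb{R}^N\setminus\overline\Omega$. Spaces: set $$\mathcal{F}_R(\rho,\psi)=\frac{C_{N,s}}{2}\iint_{\mathbb{R}^{2N}\setminus(\mathbb{R}^N\setminus\Omega)^2}\frac{(\rho(x)-\rho(y))(\psi(x)-\psi(y))}{|x-y|^{N+2s}}\,dx\,dy,$$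 and let $\mathbb{H}^s_\Omega$ be the Hilbert space of measurable $\rho:\mathbb{R}^N\to\mathbb{R}$ with finite norm $\|\rho\|_{\mathbb{H}^s_\Omega}=\big(\|\rho\|^2_{L^2(\mathbb{R}^N)}+\mathcal{F}_R(\rho,\rho)\big)^{1/2}$. Its dual is $(\mathbb{H}^s_\Omega)^\star$, with $L^2(\Omega)$ as pivot space: $\mathbb{H}^s_\Omega\hookrightarrow L^2(\Omega)\hookrightarrow(\mathbb{H}^s_\Omega)^\star$, where elements of $\mathbb{H}^s_\Omega$ are restricted to $\Omega$ and $u\in L^2(\Omega)$ is identified with the functional $\psi\mapsto\int_\Omega u\psi\,dx$. Time derivatives are taken in this sense. $W(0,T;\mathbb{H}^s_\Omega)=\{\zeta\in L^2(0,T;\mathbb{H}^s_\Omega):\zeta_t\in L^2(0,T;(\mathbb{H}^s_\Omega)^\star)\}$ embeds continuously in $C([0,T];L^2(\Omega))$, so values at fixed times make sense in $L^2(\Omega)$. Let $H(Q)=\{\xi\in W(0,T;\mathbb{H}^s_\Omega):\xi(\cdot,T)=0\text{ a.e. in }\Omega\}$. Weak solution: for $f\in L^2(Q)$, $g\in L^2(\Sigma)$, $\rho_0\in L^2(\Omega)$, the weak solution is the unique $\rho\in W(0,T;\mathbb{H}^s_\Omega)$ such that for all $\phi\in H(Q)$, $$-\int_0^T\langle\phi_t,\rho\rangle_{(\mathbb{H}^s_\Omega)^\star,\mathbb{H}^s_\Omega}dt+\int_0^T\mathcal{F}_R(\rho,\phi)\,dt+\int_\Sigma\rho\phi\,dx\,dt=\int_Q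 f\phi\,dx\,dt+\int_\Sigma g\phi\,dx\,dt+\int_\Omega\rho_0\,\phi(\cdot,0)\,dx.$$ *)

(* Defs.v *)
From HB Require Import structures.
From mathcomp Require Import all_boot all_order all_algebra.
From mathcomp Require Import all_classical all_reals all_analysis.
Set Implicit Arguments.
Unset Strict Implicit.
Unset Printing Implicit Defensive.
Import Order.TTheory GRing.Theory Num.Theory.
Import numFieldNormedType.Exports.
Local Open Scope classical_set_scope.
Local Open Scope ring_scope.

(* The library topology on ['rV[R]_N] is that of the sup norm; its Borel
   sigma-algebra is the one generated by the coordinates. *)
Definition rV_coord (R : Type) (N : nat) (i : 'I_N) (x : 'rV[R]_N) : R :=
  x ord0 i.

Definition rV_display : measure_display -> measure_display.
Proof. exact. Qed.

Section rV_measurable.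
Context {d : measure_display} {T : measurableType d} {N : nat}.

Let rV_set0 : g_sigma_preimage (@rV_coord T N) set0.
Proof. exact: sigma_algebra0. Qed.

Let rV_setC A :
  g_sigma_preimage (@rV_coord T N) A -> g_sigma_preimage (@rV_coord T N) (~` A).
Proof. exact: sigma_algebraC. Qed.

Let rV_bigcup (F : (set 'rV[T]_N)^nat) :
  (forall i, g_sigma_preimage (@rV_coord T N) (F i)) ->
  g_sigma_preimage (@rV_coord T N) (\bigcup_i (F i)).
Proof. exact: sigma_algebra_bigcup. Qed.

HB.instance Definition _ := @isMeasurable.Build (rV_display d)
  'rV[T]_N (g_sigma_preimage (@rV_coord T N)) rV_set0 rV_setC rV_bigcup.
End rV_measurable.


Lemma measurable_rV_coord d (T : measurableType d) (N : nat) (i : 'I_N) :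
  measurable_fun [set: 'rV[T]_N] (rV_coord i).
Proof.
move=> _ Y mY; rewrite setTI; apply: sub_sigma_algebra => /=.
rewrite -bigcup_seq/=; exists i => /=; first by rewrite mem_index_enum.
by exists Y => //; rewrite setTI.
Qed.

Lemma measurable_fun_rV d1 d2 (T1 : measurableType d1) (T2 : measurableType d2)
    (N : nat) (f : T1 -> 'rV[T2]_N) :
  (forall i, measurable_fun [set: T1] (rV_coord i \o f)) ->
  measurable_fun [set: T1] f.
Proof.
move=> mf; suff : g_sigma_preimage (fun i => rV_coord i \o f) `<=` measurable.
  by rewrite g_sigma_preimage_comp => prefS _ A mA; apply: prefS; exists A.
apply: smallest_sub; first exact: sigma_algebra_measurable.
rewrite -bigcup_seq; apply: bigcup_sub => i _ A [B mB <-].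
exact: mf.
Qed.

(* The library proves this but its instance is not found by inference. *)
Lemma sigma_finite_product d1 d2 (T1 : measurableType d1)
    (T2 : measurableType d2) (R : realType)
    (m1 : {sigma_finite_measure set T1 -> \bar R})
    (m2 : {sigma_finite_measure set T2 -> \bar R}) :
  sigma_finite setT (m1 \x m2)%E.
Proof.
have /sigma_finiteP[F [TF ndF Foo]] := sigma_finiteT m1.
have /sigma_finiteP[G [TG ndG Goo]] := sigma_finiteT m2.
exists (fun n => F n `*` G n).
 rewrite -setXTT TF TG predeqE => -[x y]; split.
    move=> [/= [n _ Fnx] [k _ Gky]]; exists (maxn n k) => //; split.
    - by move: x Fnx; exact/subsetPset/ndF/leq_maxl.
    - by move: y Gky; exact/subsetPset/ndG/leq_maxr.
  by move=> [n _ []/= ? ?]; split; exists n.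
move=> k; have [? ?] := Foo k; have [? ?] := Goo k.
split; first exact: measurableX.
by rewrite product_measure1E// lte_mul_pinfty// ge0_fin_numE.
Qed.

Lemma sigma_finite_pushforward d1 d2 (T1 : measurableType d1)
    (T2 : measurableType d2) (R : realType) (mu : set T1 -> \bar R)
    (f : T1 -> T2) (g : T2 -> T1) :
  cancel f g -> measurable_fun [set: T2] g -> sigma_finite setT mu ->
  sigma_finite [set: T2] (pushforward mu f).
Proof.
move=> fK mg [F UF mF].
exists (fun k => g @^-1` F k) => [|k].
  by rewrite -preimage_bigcup -UF preimage_setT.
have [mFk muFk] := mF k; split.
  by rewrite -[X in measurable X]setTI; exact: mg.
rewrite /pushforward -comp_preimage (_ : _ \o _ = id) //.
by apply/funext => x /=; rewrite fK.
Qed.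

Section lebesgue_cons.
Context {R : realType} {N : nat}.
Context (mu : {sigma_finite_measure set 'rV[R]_N -> \bar R}).

Definition row_cons (z : measurableTypeR R * 'rV[R]_N) : 'rV[R]_N.+1 :=
  row_mx (const_mx z.1 : 'rV_1) z.2.

Let row_uncons (x : 'rV[R]_N.+1) : measurableTypeR R * 'rV[R]_N :=
  (x ord0 ord0, rsubmx (x : 'rV_(1 + N))).

Let row_consK : cancel row_cons row_uncons.
Proof.
move=> [a x]; rewrite /row_uncons /row_cons row_mxKr; congr pair => /=.
by rewrite mxE; case: splitP => // j _; rewrite mxE.
Qed.

Let measurable_row_cons : measurable_fun [set: measurableTypeR R * 'rV[R]_N] row_cons.
Proof.
apply: measurable_fun_rV => i.
rewrite /comp /rV_coord /row_cons /=.
case: (split_ordP (i : 'I_(1 + N))) => j ->.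
  rewrite (_ : (fun _ => _) = fst); first exact: measurable_fst.
  by apply/funext => z /=; rewrite (row_mxEl (const_mx z.1 : 'rV_1)) mxE.
rewrite (_ : (fun _ => _) = rV_coord j \o snd).
  by apply: measurableT_comp => //; exact: measurable_rV_coord.
by apply/funext => z /=; rewrite (row_mxEr (const_mx z.1 : 'rV_1)).
Qed.

Let measurable_row_uncons : measurable_fun [set: 'rV[R]_N.+1] row_uncons.
Proof.
apply/measurable_fun_pairP; split; first exact: measurable_rV_coord.
apply: measurable_fun_rV => i.
rewrite (_ : _ \o _ = rV_coord (rshift 1 i)); first exact: measurable_rV_coord.
by apply/funext => x; rewrite /= /rV_coord mxE.
Qed.

Definition lebesgue_cons : set 'rV[R]_N.+1 -> \bar R :=
  pushforward (lebesgue_measure \x mu)%E row_cons.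

Let lebesgue_cons0 : lebesgue_cons set0 = 0%E.
Proof. by rewrite /lebesgue_cons /pushforward preimage_set0 measure0. Qed.

Let lebesgue_cons_ge0 A : (0 <= lebesgue_cons A)%E.
Proof. exact: measure_ge0. Qed.

Let lebesgue_cons_sigma_additive : semi_sigma_additive lebesgue_cons.
Proof.
exact: (@measure_semi_sigma_additive _ _ _
  [the {measure set _ -> \bar R} of @pushforward _ _ _ _ _ (lebesgue_measure \x mu)%E row_cons]).
Qed.

HB.instance Definition _ := isMeasure.Build _ _ _ lebesgue_cons
  lebesgue_cons0 lebesgue_cons_ge0 lebesgue_cons_sigma_additive.

Let lebesgue_cons_sigma_finite : sigma_finite setT lebesgue_cons.
Proof.
apply: (sigma_finite_pushforward row_consK measurable_row_uncons).
exact: sigma_finite_product.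
Qed.

HB.instance Definition _ := Measure_isSigmaFinite.Build _ _ _ lebesgue_cons
  lebesgue_cons_sigma_finite.

End lebesgue_cons.

(* Lebesgue measure on R^N: the N-fold product of [lebesgue_measure]. *)
Fixpoint lebesgue_rV (R : realType) (N : nat) :
    {sigma_finite_measure set 'rV[R]_N -> \bar R} :=
  match N return {sigma_finite_measure set 'rV[R]_N -> \bar R} with
  | 0 => dirac (0 : 'rV[R]_0)
  | N'.+1 => lebesgue_cons (lebesgue_rV R N')
  end.

Definition space_time (R : realType) (N : nat) :
    {measure set ('rV[R]_N * measurableTypeR R)%type -> \bar R} :=
  (lebesgue_rV R N \x lebesgue_measure)%E.

Definition dotr (R : realType) (N : nat) (x y : 'rV[R]_N) : R :=
  \sum_(i < N) x ord0 i * y ord0 i.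

Definition enorm (R : realType) (N : nat) (x : 'rV[R]_N) : R :=
  Num.sqrt (dotr x x).

(* Up to a rigid motion, Omega is locally, near each boundary point, the strict
   epigraph of a Lipschitz function of N - 1 variables.  Here [e] is the unit
   vector of the vertical direction; [gamma] is only evaluated on the hyperplane
   orthogonal to [e]. *)
Definition lipschitz_boundary (R : realType) (N : nat) (Omega : set 'rV[R]_N) :=
  forall x0, (closure Omega `\` interior Omega) x0 ->
  exists (U : set 'rV[R]_N) (e : 'rV[R]_N) (gamma : 'rV[R]_N -> R) (L : R),
    [/\ nbhs x0 U,
        dotr e e = 1,
        forall y z, dotr y e = 0 -> dotr z e = 0 ->
          `|gamma y - gamma z| <= L * enorm (y - z) &
        forall x, U x ->
          (Omega x <-> gamma (x - dotr x e *: e) < dotr x e)].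

Definition lipschitz_domain (R : realType) (N : nat) (Omega : set 'rV[R]_N) :=
  [/\ Omega !=set0, open Omega, connected Omega, bounded_set Omega &
      lipschitz_boundary Omega].

Definition Gamma (R : realType) (z : R) : R :=
  \int[lebesgue_measure]_(t in `]0, +oo[) (t `^ (z - 1) * expR (- t)).

Definition CNs (R : realType) (N : nat) (s : R) : R :=
  s * 2 `^ (2 * s) * Gamma ((2 * s + N%:R) / 2)
  / (pi `^ (N%:R / 2) * Gamma (1 - s)).

(* Extended-real valued, so that the same expression gives both the energy
   [FRe w w] (possibly +oo) and, through [fine], the bilinear form. *)
Definition FRe (R : realType) (N : nat) (s : R) (Omega : set 'rV[R]_N)
    (w v : 'rV[R]_N -> R) : \bar R :=
  ((CNs N s / 2)%:E *
   \int[(lebesgue_rV R N \x lebesgue_rV R N)%E]_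
      (z in ~` (~` Omega `*` ~` Omega))
     ((w z.1 - w z.2) * (v z.1 - v z.2)
      / enorm (z.1 - z.2) `^ (N%:R + 2 * s))%:E)%E.

Definition FR (R : realType) (N : nat) (s : R) (Omega : set 'rV[R]_N)
    (w v : 'rV[R]_N -> R) : R := fine (FRe s Omega w v).

Definition Hs_sqnorm (R : realType) (N : nat) (s : R) (Omega : set 'rV[R]_N)
    (w : 'rV[R]_N -> R) : \bar R :=
  ((\int[lebesgue_rV R N]_x (w x ^+ 2)%:E) + FRe s Omega w w)%E.

(* Representatives of the elements of H^s_Omega; functions that agree almost
   everywhere are at [Hs_norm]-distance 0. *)
Definition Hs (R : realType) (N : nat) (s : R) (Omega : set 'rV[R]_N) :
    set ('rV[R]_N -> R) :=
  [set w | measurable_fun setT w /\ (Hs_sqnorm s Omega w < +oo)%E].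

Definition Hs_norm (R : realType) (N : nat) (s : R) (Omega : set 'rV[R]_N)
    (w : 'rV[R]_N -> R) : R := Num.sqrt (fine (Hs_sqnorm s Omega w)).

(* A functional is only meaningful on [Hs]; boundedness makes it insensitive to
   the choice of representatives. *)
Definition Hs_dual (R : realType) (N : nat) (s : R) (Omega : set 'rV[R]_N) :
    set (('rV[R]_N -> R) -> R) :=
  [set l |
    (forall (a : R) (w v : 'rV[R]_N -> R), Hs s Omega w -> Hs s Omega v ->
       l (a *: w + v) = a * l w + l v) /\
    (exists M : R, forall w, Hs s Omega w -> `|l w| <= M * Hs_norm s Omega w)].

Definition Hs_dual_norm (R : realType) (N : nat) (s : R)
    (Omega : set 'rV[R]_N) (l : ('rV[R]_N -> R) -> R) : R :=
  sup [set `|l w| | w in [set w | Hs s Omega w /\ Hs_norm s Omega w <= 1]].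

(* For L^2(0,T;X), X is a subspace of a space V of representatives and nrm a
   seminorm on X. *)

Definition simple_curve (R : realType) (V : lmodType R) (X : set V)
    (u : R -> V) :=
  exists (n : nat) (A : 'I_n -> set R) (v : 'I_n -> V),
    (forall i, measurable (A i) /\ X (v i)) /\
    (forall t, u t = \sum_(i < n) \1_(A i) t *: v i).

Definition strongly_measurable (R : realType) (T : R) (V : lmodType R)
    (X : set V) (nrm : V -> R) (u : R -> V) :=
  exists S : nat -> R -> V,
    (forall k, simple_curve X (S k)) /\
    {ae lebesgue_measure, forall t : R, t \in `]0, T[ ->
       nrm (S k t - u t) @[k --> \oo] --> (0 : R)}.

Definition bochner_L2 (R : realType) (T : R) (V : lmodType R) (X : set V)
    (nrm : V -> R) : set (R -> V) :=
  [set u |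
    [/\ {ae lebesgue_measure, forall t : R, t \in `]0, T[ -> X (u t)},
        strongly_measurable T X nrm u &
        ((\int[lebesgue_measure]_(t in `]0%R, T[) (nrm (u t) ^+ 2)%:E) < +oo)%E]].

Definition slice (R : realType) (N : nat) (zeta : 'rV[R]_N * R -> R) (t : R) :
    'rV[R]_N -> R := fun x => zeta (x, t).

(* theta in C_c^infty(0,T) *)
Definition test_function (R : realType) (T : R) (theta : R -> R) :=
  (forall n t, derivable (derive1n n theta) t 1) /\
  (exists a b : R, [/\ 0 < a, b < T &
     forall t, t \notin `[a, b] -> theta t = 0]).

(* w = zeta_t in L^2(0,T;X), X being the dual of H^s_Omega: the distributional
   derivative of the X-valued curve t |-> (psi |-> \int_Omega zeta(t) psi). *)
Definition time_derivative (R : realType) (N : nat) (s : R)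
    (Omega : set 'rV[R]_N) (T : R) (zeta : 'rV[R]_N * R -> R)
    (w : R -> ('rV[R]_N -> R) -> R) :=
  bochner_L2 T (Hs_dual s Omega) (Hs_dual_norm s Omega) w /\
  forall psi theta, Hs s Omega psi -> test_function T theta ->
    (\int[lebesgue_measure]_(t in `]0, T[)
       ((\int[lebesgue_rV R N]_(x in Omega) (zeta (x, t) * psi x))
        * derive1 theta t))
    = - (\int[lebesgue_measure]_(t in `]0, T[) (w t psi * theta t)).

(* A class in L^2(0,T;H^s_Omega) is represented by a function of (x,t), jointly
   measurable on R^N x (0,T). *)
Definition W0T (R : realType) (N : nat) (s : R) (Omega : set 'rV[R]_N) (T : R) :
    set ('rV[R]_N * R -> R) :=
  [set zeta |
    [/\ measurable_fun ([set: 'rV[R]_N] `*` `]0, T[) zeta,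
        bochner_L2 T (Hs s Omega) (Hs_norm s Omega) (slice zeta) &
        exists w, time_derivative s Omega T zeta w]].

(* c is the representative of zeta in C([0,T];L^2(Omega)). *)
Definition continuous_rep (R : realType) (N : nat) (Omega : set 'rV[R]_N)
    (T : R) (zeta : 'rV[R]_N * R -> R) (c : R -> 'rV[R]_N -> R) :=
  [/\ forall t, t \in `[0, T] ->
        c t \_ Omega \in Lfun (lebesgue_rV R N) 2%:E,
      forall t0, t0 \in `[0, T] ->
        'N[lebesgue_rV R N]_2%:E [EFin \o ((c t - c t0)%R \_ Omega)]%E
          @[t --> within `[0, T] (nbhs t0)] --> 0%E &
      {ae lebesgue_measure, forall t : R, t \in `]0, T[ ->
        c t = slice zeta t %[ae lebesgue_rV R N in Omega]}].

(* v is the value zeta(.,t0) in L^2(Omega). *)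
Definition value_at (R : realType) (N : nat) (Omega : set 'rV[R]_N)
    (T : R) (zeta : 'rV[R]_N * R -> R) (t0 : R) (v : 'rV[R]_N -> R) :=
  v \_ Omega \in Lfun (lebesgue_rV R N) 2%:E /\
  exists c, continuous_rep Omega T zeta c /\
            c t0 = v %[ae lebesgue_rV R N in Omega].

Definition HQ (R : realType) (N : nat) (s : R) (Omega : set 'rV[R]_N) (T : R) :
    set ('rV[R]_N * R -> R) :=
  [set xi | W0T s Omega T xi /\ value_at Omega T xi T (fun=> 0)].

Definition Qcyl (R : realType) (N : nat) (Omega : set 'rV[R]_N) (T : R) :
  set ('rV[R]_N * R) := Omega `*` `]0, T[.

Definition Sigma (R : realType) (N : nat) (Omega : set 'rV[R]_N) (T : R) :
  set ('rV[R]_N * R) := ~` Omega `*` `]0, T[.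

Definition weak_solution (R : realType) (N : nat) (s : R)
    (Omega : set 'rV[R]_N) (T : R) (f g : 'rV[R]_N * R -> R)
    (rho0 : 'rV[R]_N -> R) (rho : 'rV[R]_N * R -> R) :=
  W0T s Omega T rho /\
  forall (phi : 'rV[R]_N * R -> R) (phi_t : R -> ('rV[R]_N -> R) -> R)
         (phi0 : 'rV[R]_N -> R),
    HQ s Omega T phi -> time_derivative s Omega T phi phi_t ->
    value_at Omega T phi 0 phi0 ->
    - (\int[lebesgue_measure]_(t in `]0, T[) (phi_t t (slice rho t)))
    + (\int[lebesgue_measure]_(t in `]0, T[)
         (FR s Omega (slice rho t) (slice phi t)))
    + (\int[space_time R N]_(z in Sigma Omega T) (rho z * phi z))
    = (\int[space_time R N]_(z in Qcyl Omega T) (f z * phi z))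
    + (\int[space_time R N]_(z in Sigma Omega T) (g z * phi z))
    + (\int[lebesgue_rV R N]_(x in Omega) (rho0 x * phi0 x)).

(* Main.v *)
From HB Require Import structures.
Require Import Defs.
From mathcomp Require Import all_boot all_order all_algebra.
From mathcomp Require Import all_classical all_reals all_analysis.
From mathcomp Require Import measurable_realfun ess_sup_inf ring lra.
Import Order.TTheory GRing.Theory Num.Theory.
Import numFieldNormedType.Exports.
Local Open Scope classical_set_scope.
Local Open Scope ring_scope.
Set Implicit Arguments.
Unset Strict Implicit.
Unset Printing Implicit Defensive.

(** Formally, let M0, Mf and Mg be the sup norms of rho0, f and g, put
    B(t) = M0 + Mf t + Mg, and test the equation with the excess
    w = (rho - B)^+.  Inside Omega, (rho - B)_t w = (1/2) (w^2)_t, and the source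
    f - B' = f - Mf of the equation for rho - B is nonpositive; the nonlocal form
    F_R(rho, w) is nonnegative because x |-> (x - c)^+ is nondecreasing; outside
    Omega, rho - g >= rho - B gives (rho - g) w >= w^2.  As w vanishes inside
    Omega at time 0, it vanishes everywhere, so
    rho <= B <= M0 + T Mf + Mg <= e^T (M0 + Mf + Mg), since 1 + T <= e^T.

    The excess of a weak solution is not itself an admissible test function: its
    time derivative is not known to lie in L^2(0,T;(H^s)'), and already
    (1/2) d/dt of a squared norm requires an integration by parts formula in
    W(0,T).  The argument below therefore only tests with products
    psi(x) ramp(t), where psi is in H^s and ramp is piecewise affine in time,
    equal to 1 before a and to 0 after b.  Since the derivative of the ramp is
    -1/(b - a) on [a,b[, the weak equation becomes an exact identity
    (averaged_identity) between weighted time averages of rho, f and g, where rho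
    is extended by 0 outside (0,T).

    The difference of the identities for [a,b[ and for [a - h,b - h[ is an
    implicit Euler step for the sliding mean u_h(t) of rho over [t - h,t[
    (difference_identity): its time term is (u_h(b) - u_h(a)) / (b - a) up to
    the factor h, and its time profile, a trapeze of integral at most h, is the
    indicator of [b - h,b[ up to two triangular teeth of width b - a.  Now u_h(b)
    does belong to H^s, and so does its excess over a constant, so that psi can
    be chosen as the excess of u_h(b) over the barrier
    M0 min(b/h, 1) + Mf b + Mg.  The first term of the barrier takes care of the
    extension by 0: while b <= h the mean also sees negative times, and the
    initial datum enters the difference as the source rho0 / h.  Convexity of the
    square replaces the chain rule in time, and everything else is as in the
    formal argument, except for the teeth.  Their contribution is a pairing of
    the excess with the average of rho against the difference of two teeth, whose
    squared H^s norm is at most 2 (b - a) times the total energy of rho; by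
    Young's inequality with a parameter l it is bounded by a multiple of
    l (b - a) + 1/l (step_inequality).

    Summing the steps over a grid of mesh d bounds the squared norm of the excess
    inside Omega by a multiple of l d + 1/l (inside_grid).  The mean u_h(t) does
    not depend on the grid, so the mesh can be divided by k^2 with l = k, which
    makes the bound O(1/k): the excess vanishes inside Omega, and then outside
    Omega by one more step (inside_eq0, outside_eq0).  Thus all means of rho over
    the cells of all grids are at most M0 + Mf T + Mg, and Lebesgue
    differentiation in time along these cells (le_of_cell_averages) gives the
    bound for rho itself. *)

(** * Square integrable functions and their inner product *)
Lemma integrable_EFinD d (X : measurableType d) (R : realType)
    (m : {measure set X -> \bar R}) (f g : X -> R) :
  m.-integrable setT (EFin \o f) -> m.-integrable setT (EFin \o g) ->
  m.-integrable setT (EFin \o (fun x => f x + g x)).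
Proof. by move=> If Ig; have := integrableD measurableT If Ig. Qed.

Lemma integrable_EFinB d (X : measurableType d) (R : realType)
    (m : {measure set X -> \bar R}) (f g : X -> R) :
  m.-integrable setT (EFin \o f) -> m.-integrable setT (EFin \o g) ->
  m.-integrable setT (EFin \o (fun x => f x - g x)).
Proof. by move=> If Ig; have := integrableB measurableT If Ig. Qed.

Section L2.
Context d (X : measurableType d) (R : realType) (m : {measure set X -> \bar R}).
Implicit Types f g h : X -> R.

Definition L2 f :=
  measurable_fun setT f /\ (\int[m]_x (f x ^+ 2)%:E < +oo)%E.

(** Real-valued, hence total: the integral of a non-integrable product is a junk
    value, and the algebraic rules below ask for square integrable arguments. *)
Definition ip f g : R := \int[m]_x (f x * g x).

Lemma L2_mul_integrable f g : L2 f -> L2 g ->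
  m.-integrable setT (EFin \o (fun x => f x * g x)).
Proof.
move=> [mf f2] [mg g2].
have If h : measurable_fun setT h -> (\int[m]_x (h x ^+ 2)%:E < +oo)%E ->
    m.-integrable setT (EFin \o (fun x => h x ^+ 2)).
  move=> mh h2; apply/integrableP; split.
    by apply/measurable_EFinP; exact: measurable_funX.
  under eq_integral do rewrite /= ger0_norm ?sqr_ge0//.
  exact: h2.
apply: (@le_integrable _ _ _ _ _ _ _ (EFin \o (fun x => f x ^+ 2 + g x ^+ 2))) => //.
- by apply/measurable_EFinP; exact: measurable_funM.
- move=> x _ /=; rewrite lee_fin normrM [leRHS]ger0_norm ?addr_ge0 ?sqr_ge0//.
  rewrite -(real_normK (num_real (f x))) -(real_normK (num_real (g x))).
  have := sqr_ge0 (`|f x| - `|g x|); have := sqr_ge0 `|f x|; have := sqr_ge0 `|g x|.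
  by move=> *; nra.
- by apply: integrable_EFinD; exact: If.
Qed.

Lemma L2_le f g : measurable_fun setT g -> (forall x, `|g x| <= `|f x|) ->
  L2 f -> L2 g.
Proof.
move=> mg gf [mf f2]; split => //; apply: le_lt_trans f2.
apply: ge0_le_integral => //=.
- by move=> x _; rewrite lee_fin sqr_ge0.
- by apply/measurable_EFinP; exact: measurable_funX.
- by apply/measurable_EFinP; exact: measurable_funX.
- by move=> x _; rewrite lee_fin -[_ ^+ 2]real_normK ?num_real// -[leRHS]real_normK ?num_real// lerXn2r ?nnegrE.
Qed.

Lemma integrable_L2 f : measurable_fun setT f ->
  m.-integrable setT (EFin \o (fun x => f x * f x)) -> L2 f.
Proof.
move=> mf /integrableP[_]; split => //; apply: le_lt_trans b.
apply: ge0_le_integral => //=.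
- by move=> x _; rewrite lee_fin sqr_ge0.
- by apply/measurable_EFinP; exact: measurable_funX.
- by apply/measurable_EFinP; apply: measurableT_comp => //; exact: measurable_funM.
- by move=> x _; rewrite lee_fin -expr2 ler_norm.
Qed.

Lemma L2D f g : L2 f -> L2 g -> L2 (fun x => f x + g x).
Proof.
move=> Lf Lg; have [[mf _] [mg _]] := (Lf, Lg).
apply: integrable_L2; first exact: measurable_funD.
rewrite (_ : _ \o _ = EFin \o (fun x => f x * f x + f x * g x + f x * g x + g x * g x)).
  by do 3!(apply: integrable_EFinD; last exact: L2_mul_integrable);
    exact: L2_mul_integrable.
by apply/funext => x /=; congr EFin; ring.
Qed.

Lemma L2Z c f : L2 f -> L2 (fun x => c * f x).
Proof.
move=> Lf; have [mf _] := Lf.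
apply: integrable_L2; first exact: measurable_funM.
rewrite (_ : _ \o _ = (fun x => (c ^+ 2)%:E * (f x * f x)%:E)%E); last first.
  by apply/funext => x /=; rewrite -!EFinM; congr EFin; ring.
by apply: integrableZl => //; exact: L2_mul_integrable.
Qed.

Lemma L2B f g : L2 f -> L2 g -> L2 (fun x => f x - g x).
Proof.
move=> Lf /(L2Z (-1)) Lg; have := L2D Lf Lg; congr L2.
by apply/funext => x; rewrite mulN1r.
Qed.

Lemma L20 : L2 (fun=> 0).
Proof.
split; first exact: measurable_cst.
by under eq_integral do rewrite expr0n/=; rewrite integral0.
Qed.

Lemma ip_sqr f : L2 f -> (ip f f)%:E = (\int[m]_x (f x ^+ 2)%:E)%E.
Proof.
move=> Lf; rewrite /ip /Rintegral fineK//.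
exact/integral_fune_fin_num/L2_mul_integrable.
Qed.

Lemma ipC f g : ip f g = ip g f.
Proof. by apply: eq_Rintegral => x _; rewrite mulrC. Qed.

Lemma ipDl f g h : L2 f -> L2 g -> L2 h ->
  ip (fun x => f x + g x) h = ip f h + ip g h.
Proof.
move=> Lf Lg Lh; rewrite /ip -RintegralD//; try exact: L2_mul_integrable.
by apply: eq_Rintegral => x _; rewrite mulrDl.
Qed.

Lemma ipZl c f g : L2 f -> L2 g -> ip (fun x => c * f x) g = c * ip f g.
Proof.
move=> Lf Lg; rewrite /ip -RintegralZl//; last exact: L2_mul_integrable.
by apply: eq_Rintegral => x _; rewrite mulrA.
Qed.

Lemma ipBl f g h : L2 f -> L2 g -> L2 h ->
  ip (fun x => f x - g x) h = ip f h - ip g h.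
Proof.
move=> Lf Lg Lh; rewrite /ip -RintegralB//; try exact: L2_mul_integrable.
by apply: eq_Rintegral => x _; rewrite mulrBl.
Qed.

Lemma ip_ge0 f g : (forall x, 0 <= f x * g x) -> 0 <= ip f g.
Proof. by move=> fg; apply: Rintegral_ge0. Qed.

Lemma ipff_ge0 f : 0 <= ip f f.
Proof. by apply: ip_ge0 => x; rewrite -expr2 sqr_ge0. Qed.

Lemma le_ip f g f' g' : L2 f -> L2 g -> L2 f' -> L2 g' ->
  (forall x, f x * g x <= f' x * g' x) -> ip f g <= ip f' g'.
Proof.
move=> Lf Lg Lf' Lg' le; apply: le_Rintegral => //; exact: L2_mul_integrable.
Qed.

(** Both the Cauchy-Schwarz and the Young inequality come from the nonnegativity
    of the squared norm of f - c g, for a suitable c. *)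
Lemma ip_quadratic f g c : L2 f -> L2 g ->
  0 <= ip f f - 2 * c * ip f g + c ^+ 2 * ip g g.
Proof.
move=> Lf Lg; have Lcg := L2Z c Lg.
have lin h : L2 h -> ip (fun x => f x - c * g x) h = ip f h - c * ip g h.
  by move=> Lh; rewrite ipBl// ipZl.
have := ipff_ge0 (fun x => f x - c * g x).
rewrite lin; last exact: L2B.
rewrite (ipC f) (ipC g (fun x => _)) !lin// (ipC g f).
by congr (_ <= _); ring.
Qed.

Lemma ip_CS f g : L2 f -> L2 g -> ip f g ^+ 2 <= ip f f * ip g g.
Proof.
move=> Lf Lg; have /= Q c := ip_quadratic c Lf Lg.
have := ipff_ge0 f; have := ipff_ge0 g.
set a := ip f f in Q *; set b := ip g g in Q *; set c := ip f g in Q *.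
rewrite le_eqVlt => /predU1P[b0|b0] a0.
  rewrite -b0 mulr0; case: (eqVneq c 0) => [->|c0]; first by rewrite expr0n.
  (* The quadratic is affine in this case, and a - 2 (a + 1) < 0. *)
  have := Q ((a + 1) / c); rewrite -b0 mulr0 addr0.
  rewrite -mulrA -mulrA mulVf// mulr1; lra.
have := Q (c / b); rewrite expr_div_n.
have -> : a - 2 * (c / b) * c + c ^+ 2 / b ^+ 2 * b = (a * b - c ^+ 2) / b.
  by field; exact: lt0r_neq0.
by rewrite pmulr_lge0 ?invr_gt0// subr_ge0.
Qed.

Lemma ip_young l f g : 0 < l -> L2 f -> L2 g ->
  2 * ip f g <= l * ip f f + l^-1 * ip g g.
Proof.
move=> l0 Lf Lg; have := ip_quadratic l^-1 Lf Lg.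
move/(mulr_ge0 (ltW l0)).
have -> : l * (ip f f - 2 * l^-1 * ip f g + l^-1 ^+ 2 * ip g g) =
  l * ip f f + l^-1 * ip g g - 2 * ip f g by field; exact: lt0r_neq0.
by rewrite subr_ge0.
Qed.

Lemma ip_eq0 f : L2 f -> ip f f = 0 -> {ae m, forall x, f x = 0}.
Proof.
move=> Lf ff0; have := ip_sqr Lf; rewrite ff0 => /esym I0.
have mf : measurable_fun setT (fun x => (f x ^+ 2)%:E).
  by apply/measurable_EFinP; apply: measurable_funX; case: Lf.
have : ae_eq m setT (fun x => (f x ^+ 2)%:E) (cst 0)%E.
  apply/ae_eq_integral_abs => //.
  by rewrite -[RHS]I0; apply: eq_integral => x _; rewrite gee0_abs// lee_fin sqr_ge0.
apply: filterS => x /(_ I) /= [] /eqP; rewrite sqrf_eq0.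
by move/eqP.
Qed.

Lemma L2_restrict f A : measurable A -> L2 f -> L2 (f \_ A).
Proof.
move=> mA Lf; apply: L2_le (Lf).
  by apply/measurable_restrict => //; apply: measurable_funTS; case: Lf.
by move=> x; rewrite patchE; case: ifP => // _; rewrite normr0.
Qed.

End L2.

(** * Averages in one variable of a function of two variables *)
Section partial_integral.
Context d1 d2 (X : measurableType d1) (Y : measurableType d2) (R : realType).
Context (mX : {sigma_finite_measure set X -> \bar R}).
Context (mY : {sigma_finite_measure set Y -> \bar R}).
Implicit Types (G : X * Y -> R) (k : Y -> R) (H : X -> R).

Definition avg G k (x : X) : R := \int[mY]_y (G (x, y) * k y).

(** All sections, and not only almost all of them, are square integrable: avg G k
    is then given at every point by a convergent integral, and is linear in k
    without exceptional sets. *)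
Definition L2_sections G :=
  [/\ measurable_fun setT G, forall x, L2 mY (fun y => G (x, y)) &
      (\int[mX]_x \int[mY]_y (G (x, y) ^+ 2)%:E < +oo)%E].

Definition energy G : R := fine (\int[mX]_x \int[mY]_y (G (x, y) ^+ 2)%:E)%E.

Lemma measurable_int_sqrY G : measurable_fun setT G ->
  measurable_fun setT (fun x => \int[mY]_y (G (x, y) ^+ 2)%:E)%E.
Proof.
move=> mG; apply: (measurable_fun_fubini_tonelli_F (fun z => (G z ^+ 2)%:E)).
  by apply/measurable_EFinP; exact: measurable_funX.
by move=> z; rewrite lee_fin sqr_ge0.
Qed.

Lemma measurable_int_sqrX G : measurable_fun setT G ->
  measurable_fun setT (fun y => \int[mX]_x (G (x, y) ^+ 2)%:E)%E.
Proof.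
move=> mG; apply: (measurable_fun_fubini_tonelli_G (fun z => (G z ^+ 2)%:E)).
  by apply/measurable_EFinP; exact: measurable_funX.
by move=> z; rewrite lee_fin sqr_ge0.
Qed.

Lemma fubini_sqr G : measurable_fun setT G ->
  (\int[mX]_x \int[mY]_y (G (x, y) ^+ 2)%:E =
   \int[mY]_y \int[mX]_x (G (x, y) ^+ 2)%:E)%E.
Proof.
move=> mG; apply: (fubini_tonelli (fun z => (G z ^+ 2)%:E)).
  by apply/measurable_EFinP; exact: measurable_funX.
by move=> z; rewrite lee_fin sqr_ge0.
Qed.

(** Measurability of partial integrals is available for nonnegative integrands;
    the positive and the negative part of G(x,y) k(y) are integrated apart. *)
Lemma measurable_avg G k :
  measurable_fun setT G -> measurable_fun setT k -> measurable_fun setT (avg G k).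
Proof.
move=> mG mk; pose h (z : X * Y) := (G z * k z.2)%:E.
have mh : measurable_fun setT h.
  by apply/measurable_EFinP; apply: measurable_funM => //; exact: measurableT_comp.
rewrite (_ : avg G k = fine \o (fun x => fubini_F mY h^\+ x - fubini_F mY h^\- x)%E).
  apply: measurableT_comp => //; apply: emeasurable_funB.
    by apply: measurable_fun_fubini_tonelli_F; [exact: measurable_funepos|by []].
  by apply: measurable_fun_fubini_tonelli_F; [exact: measurable_funeneg|by []].
apply/funext => x; rewrite /avg /Rintegral integralE /=; congr (fine (_ - _)).
  by apply: eq_integral => y _; rewrite !funeposE.
by apply: eq_integral => y _; rewrite !funenegE.
Qed.

Lemma eq_avg G k k' : (forall x y, G (x, y) * k y = G (x, y) * k' y) ->
  avg G k = avg G k'.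
Proof. by move=> kk'; apply/funext => x; apply: eq_Rintegral => y _. Qed.

Lemma avgE G k x : avg G k x = ip mY (fun y => G (x, y)) k.
Proof. by []. Qed.

Lemma avgB G k k' x : L2_sections G -> L2 mY k -> L2 mY k' ->
  avg G (fun y => k y - k' y) x = avg G k x - avg G k' x.
Proof. by case=> _ LG _ Lk Lk'; rewrite !avgE ipC ipBl// !(ipC _ _ (fun y => G _)). Qed.

Lemma avgZ G c k x : L2_sections G -> L2 mY k ->
  avg G (fun y => c * k y) x = c * avg G k x.
Proof. by case=> _ LG _ Lk; rewrite !avgE ipC ipZl// !(ipC _ _ (fun y => G _)). Qed.

Lemma energyE G : L2_sections G ->
  ((energy G)%:E = \int[mX]_x \int[mY]_y (G (x, y) ^+ 2)%:E)%E.
Proof.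
move=> [_ _ Goo]; rewrite fineK// ge0_fin_numE//.
by apply: integral_ge0 => x _; apply: integral_ge0 => y _; rewrite lee_fin sqr_ge0.
Qed.

Lemma energy_ge0 G : 0 <= energy G.
Proof.
by apply: fine_ge0; apply: integral_ge0 => x _; apply: integral_ge0 => y _;
  rewrite lee_fin sqr_ge0.
Qed.

(** Cauchy-Schwarz in y for each x, then integration in x.  This is what makes
    averages against kernels of small square norm negligible. *)
Lemma integral_avg_sqr G k : L2_sections G -> L2 mY k ->
  (\int[mX]_x (avg G k x ^+ 2)%:E <= (ip mY k k * energy G)%:E)%E.
Proof.
move=> LG Lk; have [mG LGx _] := LG.
rewrite EFinM energyE// -ge0_integralZl//=; last 3 first.
- by apply: measurable_int_sqrY; case: LG.
- by move=> x _; apply: integral_ge0 => y _; rewrite lee_fin sqr_ge0.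
- by rewrite lee_fin ipff_ge0.
apply: ge0_le_integral => //=.
- by move=> x _; rewrite lee_fin sqr_ge0.
- by apply/measurable_EFinP/measurable_funX/measurable_avg => //; case: Lk.
- by apply: emeasurable_funM => //; exact: measurable_int_sqrY.
- move=> x _; rewrite -ip_sqr// -EFinM lee_fin avgE mulrC.
  exact: ip_CS.
Qed.

Lemma L2_avg G k : L2_sections G -> L2 mY k -> L2 mX (avg G k).
Proof.
move=> LG Lk; split; first by apply: measurable_avg; [case: LG|case: Lk].
by apply: le_lt_trans (integral_avg_sqr LG Lk) _; rewrite ltry.
Qed.

Lemma ip_avg_le G k : L2_sections G -> L2 mY k ->
  ip mX (avg G k) (avg G k) <= ip mY k k * energy G.
Proof.
move=> LG Lk; rewrite -lee_fin ip_sqr; last exact: L2_avg.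
exact: integral_avg_sqr.
Qed.

Lemma integrable_avg G k H : L2_sections G -> L2 mY k -> L2 mX H ->
  (mX \x mY)%E.-integrable setT (EFin \o (fun z => G z * (H z.1 * k z.2))).
Proof.
move=> LG Lk LH; have [[[mG _ _] [mk k2]] [mH H2]] := (LG, Lk, LH).
apply: L2_mul_integrable.
  split => //; rewrite fubini_tonelli1.
  - by case: LG.
  - by apply/measurable_EFinP; exact: measurable_funX.
  - by move=> z; rewrite lee_fin sqr_ge0.
have mHk : measurable_fun setT (fun z : X * Y => H z.1 * k z.2).
  by apply: measurable_funM; exact: measurableT_comp.
split => //; rewrite fubini_tonelli1; last 2 first.
- by apply/measurable_EFinP; exact: measurable_funX.
- by move=> z; rewrite lee_fin sqr_ge0.
rewrite /fubini_F /=.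
under eq_integral => x _.
  under eq_integral => y _ do rewrite exprMn EFinM.
  rewrite ge0_integralZl//; last 3 first.
  - by apply/measurable_EFinP; exact: measurable_funX.
  - by move=> y _; rewrite lee_fin sqr_ge0.
  - by rewrite lee_fin sqr_ge0.
  rewrite -ip_sqr//.
  over.
rewrite ge0_integralZr//; last 3 first.
- by apply/measurable_EFinP; exact: measurable_funX.
- by move=> y _; rewrite lee_fin sqr_ge0.
- by rewrite lee_fin ipff_ge0.
by rewrite -ip_sqr// -EFinM ltry.
Qed.

Lemma Rintegral_avg G k H : L2_sections G -> L2 mY k -> L2 mX H ->
  \int[(mX \x mY)%E]_z (G z * (H z.1 * k z.2)) = ip mX (avg G k) H.
Proof.
move=> LG Lk LH; rewrite /ip /Rintegral.
rewrite -integral12_prod_meas1; last exact: integrable_avg.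
congr fine; apply: eq_integral => x _; rewrite /fubini_F /=.
have LGk : mY.-integrable setT (EFin \o (fun y => G (x, y) * k y)).
  by apply: L2_mul_integrable => //; case: LG.
rewrite mulrC -RintegralZl// /Rintegral fineK; last first.
  apply: integrable_fin_num => //.
  rewrite (_ : (fun y => _) = (fun y => (H x)%:E * (G (x, y) * k y)%:E)%E); last first.
    by apply/funext => y; rewrite EFinM.
  exact: integrableZl.
by apply: eq_integral => y _; congr EFin; ring.
Qed.

(** Fubini: integrating first in x, as the weak equation does at each time,
    amounts to taking the time average first and the inner product in x next. *)
Lemma Rintegral_avg2 G k H : L2_sections G -> L2 mY k -> L2 mX H ->
  \int[mY]_y (\int[mX]_x (G (x, y) * (H x * k y))) = ip mX (avg G k) H.
Proof.
move=> LG Lk LH; rewrite -Rintegral_avg// /Rintegral.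
have IG := integrable_avg LG Lk LH.
rewrite -integral21_prod_meas1//; congr fine.
have IF := ae_integrable2 IG.
apply: ae_eq_integral => //.
- rewrite (_ : (fun y => _) = EFin \o fine \o fubini_G mX (EFin \o (fun z => G z * (H z.1 * k z.2))))//.
  by apply/measurable_EFinP; apply: measurableT_comp => //; exact: measurable_fubini_G IG.
- exact: measurable_fubini_G IG.
- apply: filterS IF => y Iy _; rewrite fineK//.
  exact: integrable_fin_num.
Qed.

End partial_integral.

(** * Open sets and bounded sets of R^N *)
Section rV.
Context (R : realType) (N : nat).
Implicit Types (Omega : set 'rV[R]_N).

Lemma measurable_box (c : 'rV[R]_N) (e : R) :
  measurable [set x : 'rV[R]_N | forall i, `|x ord0 i - c ord0 i| < e].
Proof.
rewrite (_ : [set _ | _] = \big[setI/setT]_(i < N)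
    (rV_coord i @^-1` [set r : R | `|r - c ord0 i| < e])); last first.
  rewrite -bigcap_seq; apply/seteqP; split=> [x xe i _|x xe i] /=.
    exact: xe.
  by apply: (xe i); rewrite /= mem_index_enum.
apply: big_ind => // [|i _]; first by move=> ? ?; exact: measurableI.
rewrite -[X in measurable X]setTI; apply: measurable_rV_coord => //.
rewrite (_ : [set r | _] = ball (c ord0 i) e); last first.
  by apply/seteqP; split => r /=; rewrite /ball /= distrC.
exact: measurable_ball.
Qed.

(** The sigma-algebra is generated by the coordinates, so an open set has to be
    exhibited as a countable union of boxes with rational centres and radii of
    the form 1/(k+1). *)
Lemma open_measurable_rV Omega : open Omega -> measurable Omega.
Proof.
move=> oO; pose F (qk : 'rV[rat]_N * nat) : set 'rV[R]_N :=
  [set x | forall i, `|x ord0 i - ratr (qk.1 ord0 i)| < qk.2.+1%:R^-1 :> R].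
rewrite (_ : Omega = \bigcup_(qk in [set qk | F qk `<=` Omega]) F qk); last first.
  apply/seteqP; split=> [x Ox|x [qk /=]]; last exact.
  have /nbhs_ballP[e /= e0 xeO] : nbhs x Omega by exact: open_nbhs_nbhs.
  have [k ke] : exists k : nat, k.+1%:R^-1 < e / 2 :> R.
    have [k _ /(_ k (leqnn k)) ke] := near_infty_natSinv_lt (PosNum (divr_gt0 e0 (ltr0n _ 2))).
    by exists k.
  have /choice[q qP] : forall i : 'I_N, exists q : rat,
      `|x ord0 i - ratr q| < k.+1%:R^-1.
    move=> i; have : x ord0 i - k.+1%:R^-1 < x ord0 i + k.+1%:R^-1.
      by rewrite ltrD2l gt0_cp// invr_gt0.
    move=> /rat_in_itvoo[q]; rewrite in_itv /= => /andP[q1 q2].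
    by exists q; rewrite distrC ltr_distl q1 q2.
  exists (\row_i q i, k) => /=; last by move=> i /=; rewrite mxE.
  move=> y yF; apply: xeO; split=> // i j; rewrite ord1 /ball /=.
  have := yF j; rewrite /= mxE => yq; have := qP j => xq.
  rewrite (_ : _ - _ = (x ord0 j - ratr (q j)) - (y ord0 j - ratr (q j))); last by ring.
  rewrite (le_lt_trans (ler_normB _ _))// [e]splitr.
  by apply: ltrD; apply: lt_trans ke.
rewrite bigcup_mkcond; apply: countable_bigcupT_measurable.
  exact: countableP.
move=> qk; case: ifPn => // _.
rewrite (_ : F qk = [set x | forall i, `|x ord0 i - (map_mx ratr qk.1 : 'rV[R]_N) ord0 i| < qk.2.+1%:R^-1]).
  exact: measurable_box.
by apply/seteqP; split => x xF i; have := xF i; rewrite mxE.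
Qed.

End rV.

Definition cube (R : realType) (N : nat) (e : R) : set 'rV[R]_N :=
  [set x | forall i, `|x ord0 i| < e].

Lemma measurable_cube (R : realType) (N : nat) (e : R) : measurable (@cube R N e).
Proof.
rewrite (_ : cube e = [set x : 'rV[R]_N | forall i, `|x ord0 i - (0 : 'rV_N) ord0 i| < e]).
  exact: measurable_box.
by apply/seteqP; split => x xe i; have := xe i; rewrite mxE subr0.
Qed.

Lemma lebesgue_rV_cube (R : realType) (N : nat) (e : R) :
  (lebesgue_rV R N (cube e) < +oo)%E.
Proof.
elim: N => [|N IH].
  by rewrite /= diracE; case: (_ \in _); rewrite ltry.
rewrite /= /lebesgue_cons /pushforward.
rewrite (_ : _ @^-1` _ = ball (0 : R) e `*` @cube R N e); last first.
  apply/seteqP; split => -[a x] /=; rewrite /cube /row_cons /=.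
    move=> H; split.
      have := H ord0; rewrite !mxE; case: splitP => // j _.
      by rewrite mxE /ball /= sub0r normrN.
    move=> i; have := H (rshift 1 i).
    by rewrite (row_mxEr (const_mx a : 'rV_1)).
  move=> [+ xe] i; rewrite /ball /= sub0r normrN => ae.
  case: (split_ordP (i : 'I_(1 + N))) => j ->.
    by rewrite (row_mxEl (const_mx a : 'rV_1)) mxE.
  by rewrite (row_mxEr (const_mx a : 'rV_1)); exact: xe.
have mb := measurable_ball (0 : R) e.
rewrite product_measure1E//; last exact: measurable_cube.
apply: lte_mul_pinfty => //; rewrite ge0_fin_numE//.
have [e0|e0] := ltP 0 e; last by rewrite (ball0 _ _).2// measure0.
apply: (@le_lt_trans _ _ (e *+ 2)%:E); last by rewrite ltry.
by rewrite le_eqVlt; apply/orP; left; apply/eqP; exact: (lebesgue_measure_ball (0 : R) (ltW e0)).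
Qed.

(** The norm of row vectors is the sup norm, so a bounded set lies in a cube,
    whose measure is computed by induction on the dimension. *)
Lemma bounded_finite_measure (R : realType) (N : nat) (Omega : set 'rV[R]_N) :
  measurable Omega -> bounded_set Omega -> (lebesgue_rV R N Omega < +oo)%E.
Proof.
move=> mO [M [Mreal MO]].
apply: le_lt_trans (lebesgue_rV_cube N (`|M| + 2)).
apply: le_measure; rewrite ?inE//; first exact: measurable_cube.
move=> x Ox i.
have /= xM := MO (`|M| + 1) (le_lt_trans (ler_norm M) (ltr_pwDr ltr01 (lexx _))) x Ox.
apply: (@le_lt_trans _ _ (`|M| + 1)); last by rewrite ltrD2l ltr1n.
apply: le_trans xM.
rewrite [leRHS]/Num.norm /= mx_normrE.
by apply: (le_bigmax _ (fun ij : 'I_1 * 'I_N => `|x ij.1 ij.2|) (ord0, i)).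
Qed.

(** * The nonlocal form as an inner product of weighted differences *)
Lemma Gamma_ge0 (R : realType) (z : R) : 0 <= Defs.Gamma z.
Proof. by apply: Rintegral_ge0 => t _; rewrite mulr_ge0 ?powR_ge0 ?expR_ge0. Qed.

(** The sign of the constant is all that the comparison argument asks of it. *)
Lemma CNs_ge0 (R : realType) (N : nat) (s : R) : 0 <= s -> 0 <= CNs N s.
Proof.
by move=> s0; rewrite /CNs !mulr_ge0// ?invr_ge0 ?mulr_ge0 ?powR_ge0 ?Gamma_ge0.
Qed.

(** A name for the product measure, so that it can carry the structure of a
    sigma-finite measure that Fubini's theorem in the pair of points and the time
    requires. *)
Definition lebesgue_pair (R : realType) (N : nat) :
    set ('rV[R]_N * 'rV[R]_N) -> \bar R :=
  (lebesgue_rV R N \x lebesgue_rV R N)%E.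

HB.instance Definition _ (R : realType) (N : nat) :=
  Measure.on (@lebesgue_pair R N).

HB.instance Definition _ (R : realType) (N : nat) :=
  Measure_isSigmaFinite.Build _ _ _ (@lebesgue_pair R N)
    (sigma_finite_product (lebesgue_rV R N) (lebesgue_rV R N)).

(** True even for a = b = +oo, where both sides are the conventional value of
    +oo - oo, which a positive finite factor preserves. *)
Lemma muleBr_gt0 (R : realType) (c : R) (a b : \bar R) :
  0 < c -> (0 <= a)%E -> (0 <= b)%E ->
  (c%:E * (a - b) = c%:E * a - c%:E * b)%E.
Proof.
move=> c0 a0 b0; have [bfin|] := boolP (b \is a fin_num).
  by rewrite muleBr// fin_num_adde_defl// fin_numN.
rewrite ge0_fin_numE// -leNgt leye_eq => /eqP ->.
by rewrite /= !addeNy gt0_muleNy ?lte_fin// gt0_muley ?lte_fin// addeNy.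
Qed.

(** A positive constant commutes with the positive and the negative part, so it
    may leave the integral of a function that is not integrable. *)
Lemma integralZl_gt0 d (X : measurableType d) (R : realType)
    (m : {measure set X -> \bar R}) (c : R) (f : X -> R) :
  0 < c -> measurable_fun setT f ->
  (\int[m]_x (c * f x)%:E = c%:E * \int[m]_x (f x)%:E)%E.
Proof.
move=> c0 mf; rewrite integralE [X in (_ * X)%E]integralE.
have mFf : measurable_fun setT (EFin \o f) by exact/measurable_EFinP.
have -> : (\int[m]_x ((fun x => (c * f x)%:E)^\+ x) =
    c%:E * \int[m]_x ((fun x => (f x)%:E)^\+ x))%E.
  rewrite -ge0_integralZl//; [|exact: measurable_funepos|by rewrite lee_fin ltW].
  by apply: eq_integral => x _; rewrite !funeposE maxe_pMr ?lee_fin ?ltW// mule0.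
have -> : (\int[m]_x ((fun x => (c * f x)%:E)^\- x) =
    c%:E * \int[m]_x ((fun x => (f x)%:E)^\- x))%E.
  rewrite -ge0_integralZl//; [|exact: measurable_funeneg|by rewrite lee_fin ltW].
  by apply: eq_integral => x _; rewrite !funenegE maxe_pMr ?lee_fin ?ltW// mule0 muleN.
by apply/esym/muleBr_gt0 => //; exact: integral_ge0.
Qed.

Section Hs.
Context (R : realType) (N : nat) (s : R) (Omega : set 'rV[R]_N).
Hypotheses (mO : measurable Omega) (s_ge0 : 0 <= s).
Local Notation leb := (lebesgue_rV R N).
Local Notation leb2 := (@lebesgue_pair R N).
Implicit Types (w v : 'rV[R]_N -> R) (z : 'rV[R]_N * 'rV[R]_N).

Definition interaction : set ('rV[R]_N * 'rV[R]_N) := ~` (~` Omega `*` ~` Omega).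

(** The indicator carries the domain of integration, and the constant C_{N,s}/2
    is put under the integral.  With the square root of the weight distributed
    over the differences, F_R(w,v) becomes the inner product in L^2(R^N x R^N) of
    wdiff w and wdiff v: H^s embeds isometrically in a product of L^2 spaces, and
    the facts about ip apply to the nonlocal form. *)
Definition weight z : R :=
  CNs N s / 2 * (\1_interaction z / enorm (z.1 - z.2) `^ (N%:R + 2 * s)).

Definition wdiff w z : R := (w z.1 - w z.2) * Num.sqrt (weight z).

Lemma weight_ge0 z : 0 <= weight z.
Proof.
by apply: mulr_ge0; apply: divr_ge0; rewrite ?CNs_ge0 ?powR_ge0 ?indicE.
Qed.

Lemma measurable_interaction : measurable interaction.
Proof. by apply: measurableC; apply: measurableX; exact: measurableC. Qed.

Lemma measurable_inv_kernel :
  measurable_fun setT (fun z => (enorm (z.1 - z.2) `^ (N%:R + 2 * s))^-1).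
Proof.
rewrite (_ : (fun z => _) = (@powR R ^~ (- (N%:R + 2 * s))) \o Num.sqrt \o
  (fun z => \sum_(i < N) (rV_coord i z.1 - rV_coord i z.2) ^+ 2)).
  apply: measurableT_comp.
    apply: measurableT_comp; first exact: measurable_powR.
    by apply: continuous_measurable_fun; exact: sqrt_continuous.
  apply: measurable_sum => i; apply: measurable_funX; apply: measurable_funB.
    by apply: measurableT_comp => //; exact: measurable_rV_coord.
  by apply: measurableT_comp => //; exact: measurable_rV_coord.
apply/funext => z /=; rewrite powRN /enorm /dotr; congr ((Num.sqrt _ `^ _)^-1).
by apply: eq_bigr => i _; rewrite !mxE expr2.
Qed.

Lemma measurable_weight : measurable_fun setT weight.
Proof.
apply: measurable_funM => //; apply: measurable_funM.
  by apply: measurable_indic; exact: measurable_interaction.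
exact: measurable_inv_kernel.
Qed.

Lemma measurable_wdiff w : measurable_fun setT w -> measurable_fun setT (wdiff w).
Proof.
move=> mw; apply: measurable_funM.
  by apply: measurable_funB; exact: measurableT_comp.
apply: measurableT_comp; last exact: measurable_weight.
by apply: continuous_measurable_fun; exact: sqrt_continuous.
Qed.

Lemma wdiffM w v z : wdiff w z * wdiff v z =
  CNs N s / 2 * (((w z.1 - w z.2) * (v z.1 - v z.2)
      / enorm (z.1 - z.2) `^ (N%:R + 2 * s)) * \1_interaction z).
Proof.
rewrite /wdiff mulrACA -expr2 sqr_sqrtr ?weight_ge0// /weight; ring.
Qed.

Lemma FReE w v : measurable_fun setT w -> measurable_fun setT v ->
  FRe s Omega w v = (\int[leb2]_z (wdiff w z * wdiff v z)%:E)%E.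
Proof.
move=> mw mv; rewrite /FRe.
pose F z := (w z.1 - w z.2) * (v z.1 - v z.2) / enorm (z.1 - z.2) `^ (N%:R + 2 * s).
have mF : measurable_fun setT (F \_ interaction).
  apply/measurable_restrict => //; first exact: measurable_interaction.
  apply: measurable_funTS; apply: measurable_funM; last exact: measurable_inv_kernel.
  by apply: measurable_funM; apply: measurable_funB; exact: measurableT_comp.
rewrite integral_mkcond.
rewrite -/interaction -[X in (_ * \int[_]_x (X \_ _) x)%E]/(EFin \o F).
under eq_integral do rewrite restrict_EFin.
under [RHS]eq_integral => z _.
  rewrite wdiffM (_ : _ * \1_interaction z = (F \_ interaction) z); last first.
    by rewrite patchE indicE; case: (_ \in _); rewrite ?mulr1 ?mulr0.
  over.
have := CNs_ge0 N s_ge0; rewrite le_eqVlt => /predU1P[C0|C0].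
  rewrite -C0 mul0r mul0e.
  by under [RHS]eq_integral do rewrite mul0r; rewrite integral0.
by rewrite [RHS]integralZl_gt0// divr_gt0.
Qed.

Lemma FRe_sqr w : measurable_fun setT w ->
  FRe s Omega w w = (\int[leb2]_z (wdiff w z ^+ 2)%:E)%E.
Proof.
by move=> mw; rewrite FReE.
Qed.

Lemma HsP w : Hs s Omega w <-> L2 leb w /\ L2 leb2 (wdiff w).
Proof.
split=> [[mw]|[[mw w2] [_ dw2]]]; last first.
  by split => //; rewrite /Hs_sqnorm FRe_sqr// lte_add_pinfty.
rewrite /Hs_sqnorm FRe_sqr// => H.
have w0 : (0 <= \int[leb]_x (w x ^+ 2)%:E)%E.
  by apply: integral_ge0 => x _; rewrite lee_fin sqr_ge0.
have d0 : (0 <= \int[leb2]_z (wdiff w z ^+ 2)%:E)%E.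
  by apply: integral_ge0 => x _; rewrite lee_fin sqr_ge0.
split; split => //; [|exact: measurable_wdiff|].
  by apply: le_lt_trans H; rewrite leeDl.
by apply: le_lt_trans H; rewrite leeDr.
Qed.

Lemma FR_ip w v : measurable_fun setT w -> measurable_fun setT v ->
  FR s Omega w v = ip leb2 (wdiff w) (wdiff v).
Proof. by move=> mw mv; rewrite /FR FReE. Qed.

Definition Hs_form w v : R := ip leb w v + ip leb2 (wdiff w) (wdiff v).

Lemma Hs_sqnormE w : Hs s Omega w -> Hs_sqnorm s Omega w = (Hs_form w w)%:E.
Proof.
by move=> /HsP[Lw Ldw]; rewrite /Hs_sqnorm FRe_sqr ?EFinD ?ip_sqr//; case: Lw.
Qed.

Lemma Hs_form_ge0 w : 0 <= Hs_form w w.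
Proof. by rewrite addr_ge0 ?ipff_ge0. Qed.

Lemma Hs_normE w : Hs s Omega w -> Hs_norm s Omega w = Num.sqrt (Hs_form w w).
Proof. by move=> Hw; rewrite /Hs_norm Hs_sqnormE. Qed.

Lemma Hs_norm_sqr w : Hs s Omega w -> Hs_norm s Omega w ^+ 2 = Hs_form w w.
Proof. by move=> Hw; rewrite Hs_normE// sqr_sqrtr ?Hs_form_ge0. Qed.

Lemma HsZ c w : Hs s Omega w -> Hs s Omega (fun x => c * w x).
Proof.
move=> /HsP[Lw Ldw]; apply/HsP; split; first exact: L2Z.
rewrite (_ : wdiff _ = (fun z => c * wdiff w z)); first exact: L2Z.
by apply/funext => z; rewrite /wdiff; ring.
Qed.

Lemma Hs_normZ c w : Hs s Omega w ->
  Hs_norm s Omega (fun x => c * w x) = `|c| * Hs_norm s Omega w.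
Proof.
move=> Hw; rewrite !Hs_normE//; last exact: HsZ.
rewrite -sqrtr_sqr -sqrtrM ?sqr_ge0//; congr Num.sqrt.
have [Lw Ldw] := (HsP w).1 Hw.
rewrite /Hs_form (_ : wdiff (fun x => _) = (fun z => c * wdiff w z)); last first.
  by apply/funext => z; rewrite /wdiff; ring.
by rewrite !ipZl ?(ipC _ _ (fun x => c * _)) ?ipZl//; [ring|exact: L2Z..].
Qed.

Lemma Hs0 : Hs s Omega (fun=> 0).
Proof.
apply/HsP; split; first exact: L20.
rewrite (_ : wdiff _ = fun=> 0); first exact: L20.
by apply/funext => z; rewrite /wdiff; ring.
Qed.

(** Normal contractions operate on H^s: the weighted differences are compared
    pointwise.  Truncations are the case of interest. *)
Lemma Hs_le w v : measurable_fun setT v -> (forall x, `|v x| <= `|w x|) ->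
  (forall x y, `|v x - v y| <= `|w x - w y|) -> Hs s Omega w ->
  Hs s Omega v /\ Hs_form v v <= Hs_form w w.
Proof.
move=> mv vw dvw /HsP[Lw Ldw].
have wd z : `|wdiff v z| <= `|wdiff w z|.
  by rewrite !normrM ler_wpM2r.
have Lv := L2_le mv vw Lw; have Ldv := L2_le (measurable_wdiff mv) wd Ldw.
split; first exact/HsP.
have sq (a b : R) : `|a| <= `|b| -> a * a <= b * b.
  by rewrite -!expr2 -[X in _ -> X <= _]real_normK ?num_real// -[X in _ -> _ <= X]real_normK ?num_real// => ab; rewrite lerXn2r ?nnegrE.
by apply: lerD; apply: le_ip => // x; exact: sq.
Qed.

End Hs.

(** * Piecewise affine time profiles *)
Section ramp.
Context (R : realType).
Local Notation mu := (@lebesgue_measure R).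
Implicit Types (a b t T : R).

(** For 0 <= a < b <= T: equal to 1 up to a, to 0 from b on, affine on [a,b].  Its
    value 0 at T makes psi(x) ramp(t) an admissible test function, its value 1 at
    0 brings in the initial datum, and its constant slope on [a,b[ turns the time
    derivative in the weak equation into a mean over a window. *)
Definition ramp a b t : R := Num.max 0 (Num.min 1 ((b - t) / (b - a))).

Definition cell a b : R -> R := \1_(`[a, b[%classic : set R).

Lemma cellE a b t : cell a b t = (a <= t < b)%R%:R.
Proof. by rewrite /cell indicE mem_setE in_itv. Qed.

Definition dramp a b t : R := - (b - a)^-1 * cell a b t.

Lemma measurable_cell a b : measurable_fun setT (cell a b).
Proof. exact: measurable_indic. Qed.

Lemma L2_cell a b : L2 mu (cell a b).
Proof.
split; first exact: measurable_cell.
have -> : (\int[mu]_t (cell a b t ^+ 2)%:E = \int[mu]_t (cell a b t)%:E)%E.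
  by apply: eq_integral => t _; rewrite cellE; case: (_ && _); rewrite ?expr1n ?expr0n.
rewrite integral_indic// setIT.
have E : (mu `[a, b[%classic < +oo)%E.
  by rewrite lebesgue_measure_itv/=; case: ifP => _; rewrite -?EFinB ?ltry.
exact: E.
Qed.

Lemma ramp_ge0 a b t : 0 <= ramp a b t.
Proof. by rewrite /ramp le_max lexx. Qed.

Lemma ramp_le1 a b t : ramp a b t <= 1.
Proof. by rewrite /ramp ge_max ler01 ge_min lexx. Qed.

Lemma ramp_eq1 a b t : a < b -> t <= a -> ramp a b t = 1.
Proof.
move=> ab ta; rewrite /ramp min_l ?max_r//.
by rewrite ler_pdivlMr ?subr_gt0// mul1r lerD2l lerN2.
Qed.

Lemma ramp_eq0 a b t : a < b -> b <= t -> ramp a b t = 0.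
Proof.
move=> ab bt; rewrite /ramp max_l// ge_min; apply/orP; right.
by rewrite pmulr_lle0 ?invr_gt0 ?subr_gt0// subr_le0.
Qed.

Lemma ramp_mid a b t : a < b -> a <= t <= b -> ramp a b t = (b - t) / (b - a).
Proof.
move=> ab /andP[ta tb]; rewrite /ramp min_r; last first.
  by rewrite ler_pdivrMr ?subr_gt0// mul1r lerD2l lerN2.
by rewrite max_r// divr_ge0// subr_ge0// ltW.
Qed.

Lemma continuous_ramp a b : continuous (ramp a b).
Proof.
move=> t; apply: (@continuous_max R R (fun=> 0) (fun t => Num.min 1 ((b - t) / (b - a)))).
  exact: cvg_cst.
apply: (@continuous_min R R (fun=> 1) (fun t => ((b - t) / (b - a)))).
  exact: cvg_cst.
by apply: cvgMl; apply: cvgB; [exact: cvg_cst|exact: cvg_id].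
Qed.

Lemma measurable_ramp a b : measurable_fun setT (ramp a b).
Proof. by apply: continuous_measurable_fun; exact: continuous_ramp. Qed.

Lemma measurable_dramp a b : measurable_fun setT (dramp a b).
Proof. by apply: measurable_funM => //; exact: measurable_cell. Qed.

Lemma test_function_continuous T th : test_function T th ->
  continuous th /\ continuous (derive1 th).
Proof.
move=> [dth _]; split => t; apply/differentiable_continuous;
  rewrite -derivable1_diffP; [exact: (dth 0%N)|exact: (dth 1%N)].
Qed.

Lemma continuous_integrable_oo (f : R -> R) x y : continuous f ->
  mu.-integrable `]x, y[ (EFin \o f).
Proof.
move=> cf; have If : mu.-integrable `[x, y] (EFin \o f).
  apply: continuous_compact_integrable; first exact: segment_compact.
  exact: continuous_subspaceT.
by apply: integrableS If => //; exact: subset_itv_oo_cc.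
Qed.

Lemma integrable_ramp_test a b T th : test_function T th ->
  mu.-integrable `]0, T[ (EFin \o (fun t => ramp a b t * derive1 th t)).
Proof.
move=> /test_function_continuous[_ cth']; apply: continuous_integrable_oo => t.
by apply: cvgM; [exact: continuous_ramp|exact: cth'].
Qed.

Lemma integrable_dramp_test a b T th : test_function T th ->
  mu.-integrable `]0, T[ (EFin \o (fun t => dramp a b t * th t)).
Proof.
move=> /test_function_continuous[cth _].
have Ith : mu.-integrable `]0, T[ (EFin \o (fun t => (b - a)^-1 * th t)).
  by apply: continuous_integrable_oo => t; apply: cvgMr; exact: cth.
apply: le_integrable Ith => //.
- apply/measurable_EFinP/measurable_funTS/measurable_funM; first exact: measurable_dramp.
  exact: continuous_measurable_fun.
- move=> t _ /=; rewrite lee_fin !normrM normrN ler_wpM2r// ler_piMr// cellE.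
  by case: (_ && _); rewrite ?normr1 ?normr0.
Qed.

(** The ramp is not differentiable at a and b, so its distributional derivative
    is identified by splitting the integral at these points. *)
Lemma ramp_by_parts a b T (th : R -> R) : 0 <= a -> a < b -> b <= T ->
  test_function T th ->
  \int[mu]_(t in `]0, T[) (ramp a b t * (derive1 th) t) =
  - \int[mu]_(t in `]0, T[) (dramp a b t * th t).
Proof.
move=> a0 ab bT tth; have [cth cth'] := test_function_continuous tth.
move: tth => [dth [a' [b' [a'0 b'T th0]]]].
have cth'w A : {within A, continuous (derive1 th)} by exact: continuous_subspaceT.
have cthw A : {within A, continuous th} by exact: continuous_subspaceT.
have LRth x y : derivable_oo_LRcontinuous th x y.
  split; first by move=> t _; exact: (dth 0%N).
    by apply: cvg_at_right_filter; exact: cth.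
  by apply: cvg_at_left_filter; exact: cth.
pose q t := (b - t) / (b - a).
have cq : continuous q.
  by move=> t; apply: cvgMl; apply: cvgB; [exact: cvg_cst|exact: cvg_id].
have ba : b - a != 0 by rewrite subr_eq0 gt_eqF.
have Dq t : is_derive t 1 q (- (b - a)^-1).
  have : is_derive t (1 : R) ((b - a)^-1 \*: (cst b - id : R^o -> R^o))
      ((b - a)^-1 *: (0 - 1 : R)) by exact: is_deriveZ.
  congr is_derive; first by apply/funext => x /=; rewrite /q /GRing.scale /= mulrC.
  by rewrite sub0r scalerN /GRing.scale /= mulr1.
have dq t : derivable q t 1 by case: (Dq t).
have q' t : derive1 q t = - (b - a)^-1 by rewrite derive1E; case: (Dq t).
have LRq : derivable_oo_LRcontinuous q a b.
  split; first by move=> t _; exact: dq.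
    by apply: cvg_at_right_filter; exact: cq.
  by apply: cvg_at_left_filter; exact: cq.
have Icc (f : R -> R) x y : continuous f -> mu.-integrable `[x, y] (EFin \o f).
  move=> cf; apply: continuous_compact_integrable; first exact: segment_compact.
  exact: continuous_subspaceT.
have Ioo (f : R -> R) x y : continuous f -> mu.-integrable `]x, y[ (EFin \o f).
  by move=> cf; apply: integrableS (Icc f x y cf) => //; exact: subset_itv_oo_cc.
have Ioc (f : R -> R) x y : continuous f -> mu.-integrable `]x, y] (EFin \o f).
  by move=> cf; apply: integrableS (Icc f x y cf) => //; exact: subset_itv_oc_cc.
have Ico (f : R -> R) x y : continuous f -> mu.-integrable `[x, y[ (EFin \o f).
  by move=> cf; apply: integrableS (Icc f x y cf) => //; exact: subset_itv_co_cc.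
have cqth : continuous (fun t => q t * (derive1 th) t).
  by move=> t; apply: cvgM; [exact: cq|exact: cth'].
have th_0 : th 0 = 0 by apply: th0; rewrite in_itv /= leNgt a'0.
have th_T : th T = 0 by apply: th0; rewrite in_itv /= negb_and -!ltNge b'T orbT.
(* By parts on [a,b], where the ramp is affine; the boundary terms cancel
   because the ramp equals 1 at a and 0 at b, and th vanishes at 0 and at T. *)
transitivity (\int[mu]_(t in `]0, a]) ((derive1 th) t) +
              \int[mu]_(t in `]a, b[) (q t * (derive1 th) t)).
  rewrite Rintegral_mkcond [X in _ = X + _]Rintegral_mkcond [X in _ = _ + X]Rintegral_mkcond.
  rewrite -RintegralD//; last 2 first.
  - by rewrite -restrict_EFin; apply/integrable_restrict => //; rewrite setTI; exact: Ioc.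
  - by rewrite -restrict_EFin; apply/integrable_restrict => //; rewrite setTI; exact: Ioo.
  apply: eq_Rintegral => t _; rewrite !patchE !mem_setE !in_itv /=.
  have [ta|ta] := leP t a.
    rewrite andbT /= addr0 ramp_eq1// mul1r (le_lt_trans ta) ?andbT//.
    exact: lt_le_trans ab bT.
  rewrite andbF add0r /=; have [tb|tb] := ltP t b.
    by rewrite (le_lt_trans a0 ta) (lt_le_trans tb bT) /= ramp_mid// !ltW.
  by rewrite ramp_eq0// mul0r; case: ifP.
rewrite Rintegral_itv_obnd_cbnd; last exact: Ioo.
rewrite Rintegral_itv_obnd_cbnd; last exact: Ioc.
rewrite Rintegral_itv_bndo_bndc; last exact: Ico.
rewrite (@Rintegration_by_parts _ q th (fun=> - (b - a)^-1) (derive1 th) a b)//; last first.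
  by apply: continuous_subspaceT => ?; exact: cvg_cst.
have -> : \int[mu]_(t in `[0, a]) ((derive1 th) t) = th a.
  move: a0; rewrite le_eqVlt => /predU1P[<-|a0].
    by rewrite set_itv1 Rintegral_set1.
  by rewrite /Rintegral (@continuous_FTC2 _ (derive1 th) th)//= th_0 subr0.
rewrite /q subrr mul0r mul0r divff// mul1r sub0r addrA subrr sub0r; congr (- _).
rewrite -Rintegral_itv_bndo_bndc; last first.
  by apply: Ico => t; apply: cvgMr; exact: cth.
rewrite [RHS]Rintegral_mkcond [LHS]Rintegral_mkcond.
apply: eq_Rintegral => t _; rewrite !patchE !mem_setE /dramp cellE !in_itv /=.
have [/andP[ta tb]|_] := boolP (a <= t < b); last by rewrite mulr0 mul0r; case: ifP.
rewrite mulr1 (lt_le_trans tb bT) andbT; case: ltP => // t0.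
by rewrite (_ : t = 0) ?th_0 ?mulr0//; apply/eqP; rewrite eq_le t0 (le_trans a0 ta).
Qed.

End ramp.

(** * Test functions that are products of a function of x and a ramp *)
Section L2_Lfun.
Context d (X : measurableType d) (R : realType) (m : {measure set X -> \bar R}).
Implicit Types f : X -> R.

Lemma Lnorm2E f : L2 m f -> ('N[m]_2%:E[EFin \o f] = (Num.sqrt (ip m f f))%:E)%E.
Proof.
move=> Lf; rewrite unlock -powR12_sqrt ?ipff_ge0// -poweR_EFin ip_sqr//.
congr (_ `^ _)%E; apply: eq_integral => x _.
by rewrite /= powR_mulrn ?normr_ge0// real_normK ?num_real.
Qed.

Lemma L2_Lfun f : L2 m f -> f \in Lfun m 2%:E.
Proof.
move=> Lf; have [mf _] := Lf; rewrite inE; apply/andP; split.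
  by rewrite inE.
by rewrite inE /= /finite_norm Lnorm2E// ltry.
Qed.

Lemma Lfun_L2 f : f \in Lfun m 2%:E -> L2 m f.
Proof.
move=> Lf; apply: integrable_L2; first by move: Lf; rewrite inE => /andP[]; rewrite inE.
exact: Lfun2_integrable_sqr.
Qed.

End L2_Lfun.

Section strongly_measurable_scale.
Context (R : realType) (V : lmodType R) (T : R) (D : set V) (nrm : V -> R).

(** Simple curves approximating t |-> r(t) v are obtained by rounding r(t) down
    to a multiple of 1/(k+1); the error has norm at most |v|/(k+1), for every t. *)
Lemma strongly_measurable_scale (v : V) (r : R -> R) :
  (forall c, D (c *: v)) -> (forall c, nrm (c *: v) = `|c| * nrm v) -> 0 <= nrm v ->
  measurable_fun setT r -> (forall t, 0 <= r t <= 1) ->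
  strongly_measurable T D nrm (fun t => r t *: v).
Proof.
move=> Dv nv nv0 mr r01.
pose tr k t := Num.truncn (r t * k.+1%:R).
have r0 k t : 0 <= r t * k.+1%:R by case/andP: (r01 t) => ? _; rewrite mulr_ge0.
pose A k i := [set t | tr k t = i].
have mA k i : measurable (A k i).
  rewrite (_ : A k i = (fun t => r t * k.+1%:R) @^-1` `[i%:R, i.+1%:R[).
    rewrite -[X in measurable X]setTI.
    by apply: measurable_funM => //; exact: measurable_itv.
  apply/seteqP; split => t; rewrite /A /tr /= in_itv /= -truncn_eq//.
    by move=> ->.
  by move/eqP.
have trk k t : (tr k t < k.+2)%N.
  have /andP[rt0 rt1] := r01 t.
  rewrite -(ltr_nat R); case/andP: (truncn_itv (r0 k t)) => /le_lt_trans + _.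
  by apply; rewrite (@le_lt_trans _ _ k.+1%:R) ?ltr_nat// ler_piMl.
pose S k t : V := \sum_(i < k.+2) \1_(A k i) t *: ((i%:R / k.+1%:R) *: v).
have SE k t : S k t = ((tr k t)%:R / k.+1%:R) *: v.
  rewrite /S (bigD1 (Ordinal (trk k t)))//= big1 ?addr0.
    by rewrite indicE mem_set//= scale1r.
  move=> i it; rewrite indicE memNset ?scale0r// /A /= => tri.
  by move/eqP: it; apply; apply/val_inj.
exists S; split.
  move=> k; exists k.+2, (A k), (fun i => (i%:R / k.+1%:R) *: v).
  by split.
apply: aeW => t _.
have E k : S k t - r t *: v = ((tr k t)%:R / k.+1%:R - r t) *: v.
  by rewrite SE scalerBl.
apply: (@squeeze_cvgr _ _ _ _ (fun=> 0) (fun k => k.+1%:R^-1 * nrm v)).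
- near=> k; rewrite E nv mulr_ge0//= ler_wpM2r//.
  case/andP: (truncn_itv (r0 k t)) => h1 h2.
  rewrite ler0_norm.
    rewrite opprB lerBlDr -[X in X + _]mul1r -mulrDl ler_pdivlMr// ltW//.
    by apply: lt_le_trans h2 _; rewrite -natr1 addrC.
  by rewrite subr_le0 ler_pdivrMr.
- exact: cvg_cst.
- rewrite -[X in _ --> X](mul0r (nrm v)); apply: cvgMl.
  apply/cvgrPdist_lt => e e0; near=> k; rewrite sub0r normrN ger0_norm ?invr_ge0//.
  by near: k; exact: (near_infty_natSinv_lt (PosNum e0)).
Unshelve. all: end_near. Qed.

End strongly_measurable_scale.

Section test.
Context (R : realType) (N : nat) (s : R) (Omega : set 'rV[R]_N).
Hypotheses (mO : measurable Omega) (s_ge0 : 0 <= s).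
Local Notation leb := (lebesgue_rV R N).
Local Notation mu := (@lebesgue_measure R).

(** The functional on H^s that represents the restriction of v to Omega, in the
    identification with L^2(Omega) as pivot space. *)
Definition pairing (v w : 'rV[R]_N -> R) : R := \int[leb]_(x in Omega) (w x * v x).

Lemma pairingE v w : pairing v w = ip leb w (v \_ Omega).
Proof.
rewrite /pairing Rintegral_mkcond; apply: eq_Rintegral => x _.
by rewrite !patchE; case: ifP => //; rewrite mulr0.
Qed.

(** Cauchy-Schwarz on Omega, the norm of H^s dominating that of L^2(R^N). *)
Lemma pairing_dual v : L2 leb v -> Hs_dual s Omega (pairing v).
Proof.
move=> Lv; have LvO := L2_restrict mO Lv; split.
  move=> a w1 w2 /(HsP mO s_ge0)[L1 _] /(HsP mO s_ge0)[L2 _].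
  rewrite !pairingE -ipZl// -ipDl//.
  exact: L2Z.
exists (Num.sqrt (ip leb (v \_ Omega) (v \_ Omega))) => w Hw.
have [Lw _] := (HsP mO s_ge0 w).1 Hw.
rewrite pairingE Hs_normE// -sqrtr_sqr -sqrtrM ?ipff_ge0// ler_sqrt; last first.
  by rewrite mulr_ge0 ?ipff_ge0 ?Hs_form_ge0.
rewrite (le_trans (ip_CS Lw LvO))// mulrC ler_wpM2l ?ipff_ge0//.
by rewrite lerDl ipff_ge0.
Qed.

Variables (T a b : R) (psi : 'rV[R]_N -> R).
Hypotheses (a_ge0 : 0 <= a) (ab : a < b) (bT : b <= T) (Hpsi : Hs s Omega psi).

Definition test_fun (z : 'rV[R]_N * R) : R := psi z.1 * ramp a b z.2.

Definition test_fun_t (t : R) : ('rV[R]_N -> R) -> R :=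
  pairing (fun x => psi x * dramp a b t).

Let Lpsi : L2 leb psi. Proof. by case/(HsP mO s_ge0) : Hpsi. Qed.

Let sliceE t : slice test_fun t = ramp a b t *: psi.
Proof. by apply/funext => x; rewrite /slice /test_fun /= mulrC. Qed.

Let muT : mu `]0, T[%classic = T%:E.
Proof.
have T0 : 0 < T by rewrite (lt_le_trans _ bT)// (le_lt_trans a_ge0).
by rewrite lebesgue_measure_itv/= lte_fin T0 sube0.
Qed.

Lemma bochner_L2_test_fun :
  bochner_L2 T (Hs s Omega) (Hs_norm s Omega) (slice test_fun).
Proof.
split.
- by apply: aeW => t _; rewrite sliceE; exact: HsZ.
- rewrite (_ : slice _ = fun t => ramp a b t *: psi); last exact/funext/sliceE.
  apply: strongly_measurable_scale.
  + by move=> c; exact: HsZ.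
  + by move=> c; exact: Hs_normZ.
  + by rewrite Hs_normE// sqrtr_ge0.
  + exact: measurable_ramp.
  + by move=> t; rewrite ramp_ge0 ramp_le1.
- pose C := Hs_norm s Omega psi ^+ 2.
  apply: (@le_lt_trans _ _ (\int[mu]_(t in `]0%R, T[) C%:E)%E).
    apply: ge0_le_integral => //=.
    + by move=> t _; rewrite lee_fin sqr_ge0.
    + rewrite (_ : (fun _ => _) = EFin \o (fun t => (ramp a b t * Hs_norm s Omega psi) ^+ 2)).
        apply/measurable_EFinP/measurable_funTS/measurable_funX/measurable_funM => //.
        exact: measurable_ramp.
      apply/funext => t /=; rewrite sliceE Hs_normZ// ger0_norm//; exact: ramp_ge0.
    + move=> t _; rewrite lee_fin sliceE Hs_normZ// exprMn ler_piMl ?sqr_ge0//.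
      rewrite real_normK ?num_real// expr_le1//; first exact: ramp_le1.
      exact: ramp_ge0.
  by rewrite integral_cst//= muT -EFinM ltry.
Qed.

(** As a curve in the dual, the time derivative of the test function is a simple
    curve: a fixed functional on the window [a,b[ and 0 elsewhere. *)
Lemma test_fun_tE t : test_fun_t t =
  cell a b t *: pairing (fun x => psi x * - (b - a)^-1).
Proof.
apply/funext => w; have -> c (l : ('rV[R]_N -> R) -> R) : (c *: l) w = c * l w by [].
rewrite /test_fun_t /dramp cellE; case: (_ && _); first by rewrite mulr1 mul1r.
rewrite mul0r /pairing; under eq_Rintegral do rewrite !mulr0.
by rewrite Rintegral_cst// mul0r.
Qed.

Let Lpsic : L2 leb (fun x => psi x * - (b - a)^-1).
Proof.
rewrite (_ : (fun x => _) = fun x => - (b - a)^-1 * psi x); first exact: L2Z.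
by apply/funext => x; rewrite mulrC.
Qed.

Let dual0 : Hs_dual s Omega 0.
Proof.
split; first by move=> *; rewrite /= mulr0 addr0.
by exists 0 => w _; rewrite normr0 mul0r.
Qed.

Lemma test_fun_t_dual t : Hs_dual s Omega (test_fun_t t).
Proof.
rewrite test_fun_tE cellE; case: (_ && _); rewrite ?scale1r ?scale0r//.
exact: pairing_dual.
Qed.

Lemma Hs_dual_norm0 : Hs_dual_norm s Omega 0 = 0.
Proof.
rewrite /Hs_dual_norm (_ : [set _ | _ in _] = [set 0]) ?sup1//.
apply/seteqP; split => [_ [w _ <-]|_ ->] /=; first by rewrite normr0.
exists (fun=> 0); last by rewrite normr0.
split; first exact: Hs0.
have := Hs_normZ mO s_ge0 0 (Hs0 mO s_ge0).
have -> : (fun x => 0 * (fun=> 0) x) = (fun=> 0) :> ('rV[R]_N -> R).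
  by apply/funext => x; exact: mul0r.
by rewrite normr0 mul0r => ->; exact: ler01.
Qed.

Lemma bochner_L2_test_fun_t :
  bochner_L2 T (Hs_dual s Omega) (Hs_dual_norm s Omega) test_fun_t.
Proof.
split.
- by apply: aeW => t _; exact: test_fun_t_dual.
- exists (fun _ => test_fun_t); split=> [_|].
    exists 1, (fun=> `[a, b[%classic), (fun=> pairing (fun x => psi x * - (b - a)^-1)).
    split=> [i|t]; first by split => //; exact: pairing_dual.
    by rewrite big_ord_recl big_ord0 addr0 test_fun_tE.
  apply: aeW => t _; rewrite subrr Hs_dual_norm0; exact: cvg_cst.
- pose c1 := Hs_dual_norm s Omega (pairing (fun x => psi x * - (b - a)^-1)) ^+ 2.
  apply: (@le_lt_trans _ _ (\int[mu]_(t in `]0%R, T[) c1%:E)%E).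
    have E t : Hs_dual_norm s Omega (test_fun_t t) ^+ 2 = c1 * cell a b t.
      rewrite test_fun_tE cellE; case: (_ && _).
        by rewrite scale1r mulr1.
      by rewrite scale0r Hs_dual_norm0 expr0n mulr0.
    apply: ge0_le_integral => //=.
    + by move=> t _; rewrite lee_fin sqr_ge0.
    + rewrite (_ : (fun _ => _) = EFin \o (fun t => c1 * cell a b t)); last first.
        by apply/funext => t /=; rewrite E.
      by apply/measurable_EFinP/measurable_funTS/measurable_funM => //; exact: measurable_cell.
    + move=> t _; rewrite lee_fin E ler_piMr ?sqr_ge0// cellE; by rewrite -[leRHS]/(1%:R) ler_nat leq_b1.
  by rewrite integral_cst//= muT -EFinM ltry.
Qed.

Lemma test_fun_time_derivative : time_derivative s Omega T test_fun test_fun_t.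
Proof.
split; first exact: bochner_L2_test_fun_t.
move=> w theta Hw tth; have [Lw _] := (HsP mO s_ge0 w).1 Hw.
have LpO := L2_restrict mO Lpsi.
pose c := ip leb w (psi \_ Omega).
have E r : \int[leb]_(x in Omega) (w x * (psi x * r)) = c * r.
  rewrite -[LHS]/(pairing (fun x => psi x * r) w) pairingE.
  rewrite (_ : _ \_ _ = fun x => r * (psi \_ Omega) x).
    by rewrite ipC ipZl// ipC mulrC.
  by apply/funext => x; rewrite !patchE; case: ifP => _; rewrite ?mulr0// mulrC.
transitivity (c * \int[mu]_(t in `]0, T[) (ramp a b t * derive1 theta t)).
  rewrite -RintegralZl//.
    apply: eq_Rintegral => t _; rewrite mulrA -E; congr (_ * _).
    by apply: eq_Rintegral => x _; rewrite mulrC.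
  exact: integrable_ramp_test tth.
rewrite (ramp_by_parts a_ge0 ab bT tth) mulrN; congr (- _).
rewrite -RintegralZl//.
  by apply: eq_Rintegral => t _; rewrite mulrA -E.
exact: integrable_dramp_test tth.
Qed.

Lemma test_fun_W0T : W0T s Omega T test_fun.
Proof.
split; [|exact: bochner_L2_test_fun|by exists test_fun_t; exact: test_fun_time_derivative].
apply: measurable_funTS; apply: measurable_funM.
  by apply: measurableT_comp => //; case: Lpsi.
by apply: measurableT_comp => //; exact: measurable_ramp.
Qed.

Lemma test_fun_continuous_rep : continuous_rep Omega T test_fun (slice test_fun).
Proof.
have L t : L2 leb (slice test_fun t) by rewrite sliceE; exact: L2Z.
split.
- by move=> t _; apply/L2_Lfun/L2_restrict.
- move=> t0 _.
  pose c := Num.sqrt (ip leb (psi \_ Omega) (psi \_ Omega)).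
  have LpO := L2_restrict mO Lpsi.
  have E t : ('N[leb]_2%:E[EFin \o ((slice test_fun t - slice test_fun t0)%R \_ Omega)]
      = (`|ramp a b t - ramp a b t0| * c)%:E)%E.
    rewrite (_ : _ \_ _ = fun x => (ramp a b t - ramp a b t0) * (psi \_ Omega) x).
      rewrite Lnorm2E; last exact: L2Z.
      rewrite ipZl//; last exact: L2Z.
      rewrite ipC ipZl// mulrA -expr2 sqrtrM ?sqr_ge0// sqrtr_sqr//.
    apply/funext => x; rewrite !sliceE !patchE; case: ifP => _; last by rewrite mulr0.
    by rewrite mulrBl.
  under eq_fun do rewrite E.
  apply: cvg_EFin; first by near=> t.
  apply: cvg_within_filter.
  have : `|ramp a b t - ramp a b t0| * c @[t --> t0] -->
      `|ramp a b t0 - ramp a b t0| * c.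
    apply: cvgMl; apply: cvg_norm.
    by apply: cvgB; [exact: continuous_ramp|exact: cvg_cst].
  by rewrite subrr normr0 mul0r.
- by apply: aeW => t _; exact: aeW.
Unshelve. all: end_near. Qed.

Lemma test_fun_value0 : value_at Omega T test_fun 0 psi.
Proof.
split; first exact/L2_Lfun/L2_restrict.
exists (slice test_fun); split; first exact: test_fun_continuous_rep.
by apply: aeW => x _; rewrite sliceE ramp_eq1// scale1r.
Qed.

Lemma test_fun_HQ : HQ s Omega T test_fun.
Proof.
split; first exact: test_fun_W0T; split.
  by apply/L2_Lfun/L2_restrict => //; exact: L20.
exists (slice test_fun); split; first exact: test_fun_continuous_rep.
by apply: aeW => x _; rewrite sliceE ramp_eq0// scale0r.
Qed.

End test.

(** * A representative of the solution *)
Lemma aeS d (X : measurableType d) (R : realType) (m : {measure set X -> \bar R})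
    (P Q : X -> Prop) :
  (forall x, P x -> Q x) -> {ae m, forall x, P x} -> {ae m, forall x, Q x}.
Proof. by move=> PQ; exact: filterS. Qed.

Lemma aeI d (X : measurableType d) (R : realType) (m : {measure set X -> \bar R})
    (P Q : X -> Prop) :
  {ae m, forall x, P x} -> {ae m, forall x, Q x} -> {ae m, forall x, P x /\ Q x}.
Proof. by apply: filterS2 => x. Qed.

Section representative.
Context (R : realType) (N : nat) (s : R) (Omega : set 'rV[R]_N) (T : R).
Hypotheses (mO : measurable Omega) (s_ge0 : 0 <= s).
Local Notation leb := (lebesgue_rV R N).
Local Notation leb2 := (@lebesgue_pair R N).
Local Notation mu := (@lebesgue_measure R).
Local Notation delta := (wdiff s Omega).
Implicit Types (r : 'rV[R]_N * R -> R) (w v : 'rV[R]_N -> R).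

(** The exceptional set of pairs is contained in the two strips over a null set
    of R^N, each of which is null by the product formula. *)
Lemma ae_wdiff w v : {ae leb, forall x, w x = v x} ->
  {ae leb2, forall z, delta w z = delta v z}.
Proof.
move=> [B [mB B0 wvB]].
have mBT : measurable (B `*` [set: 'rV[R]_N]) by exact: measurableX.
have mTB : measurable ([set: 'rV[R]_N] `*` B) by exact: measurableX.
have pairE A C : measurable A -> measurable C -> (leb2 (A `*` C) = leb A * leb C)%E.
  by move=> mA mC; exact: product_measure1E.
have nul1 : leb2.-negligible (B `*` [set: 'rV[R]_N]).
  by apply/negligibleP => //; apply: (etrans (pairE _ _ mB measurableT)); rewrite B0 mul0e.
have nul2 : leb2.-negligible ([set: 'rV[R]_N] `*` B).
  by apply/negligibleP => //; apply: (etrans (pairE _ _ measurableT mB)); rewrite B0 mule0.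
apply: negligibleS (negligibleU nul1 nul2) => z /= wz.
apply: contrapT => /not_orP[z1 z2]; apply: wz.
have E1 : w z.1 = v z.1 by apply: contrapT => n; apply: z1; split => //; exact: wvB.
have E2 : w z.2 = v z.2 by apply: contrapT => n; apply: z2; split => //; exact: wvB.
by rewrite /wdiff E1 E2.
Qed.

Definition tdiff r (z : ('rV[R]_N * 'rV[R]_N) * R) : R := delta (slice r z.2) z.1.

Lemma measurable_slice r t : measurable_fun setT r -> measurable_fun setT (slice r t).
Proof. by move=> mr; exact: measurableT_comp. Qed.

Lemma measurable_tdiff r : measurable_fun setT r -> measurable_fun setT (tdiff r).
Proof.
move=> mr; apply: measurable_funM.
  apply: measurable_funB; rewrite /slice.
    apply: (@measurableT_comp _ _ _ _ _ _ r) => //.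
    by apply: measurable_fun_pair; [exact: measurableT_comp|exact: measurable_snd].
  apply: (@measurableT_comp _ _ _ _ _ _ r) => //.
  by apply: measurable_fun_pair; [exact: measurableT_comp|exact: measurable_snd].
apply: measurableT_comp; last first.
  by apply: measurableT_comp; [exact: measurable_weight|exact: measurable_fst].
by apply: continuous_measurable_fun; exact: sqrt_continuous.
Qed.

(** A curve in L^2(0,T;H^s) is only known to be measurable on R^N x (0,T) and
    square integrable on almost every time line.  It is first extended by 0 to
    all times, and then set to 0 on the null set of those x for which the time
    line is not square integrable.  The second change affects a null set of x,
    hence a null set of pairs in the nonlocal energy at each time. *)
Lemma W0T_representative rho : W0T s Omega T rho ->
  exists r : 'rV[R]_N * R -> R,
  [/\ L2_sections leb mu r, L2_sections leb2 mu (tdiff r),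
      forall x t, t \notin `]0, T[ -> r (x, t) = 0 &
      {ae leb, forall x, forall t, t \in `]0, T[ -> r (x, t) = rho (x, t)}].
Proof.
move=> [mrho [rhoH _ rho2] _].
pose r1 := rho \_ ([set: 'rV[R]_N] `*` `]0, T[%classic).
have m0T : measurable (`]0, T[%classic : set (measurableTypeR R)) by exact: measurable_itv.
have mr1 : measurable_fun setT r1.
  by apply/(measurable_restrictT _ _).1 => //; exact: measurableX.
have r1E x t : t \in `]0, T[ -> r1 (x, t) = rho (x, t).
  by move=> tT; rewrite /r1 patchE mem_set.
have r10 x t : t \notin `]0, T[ -> r1 (x, t) = 0.
  by move=> tT; rewrite /r1 patchE memNset//= => -[_]; apply/negP.
have s1E t : t \in `]0, T[ -> slice r1 t = slice rho t.
  by move=> tT; apply/funext => x; exact: r1E.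
have s10 t : t \notin `]0, T[ -> slice r1 t = fun=> 0.
  by move=> tT; apply/funext => x; exact: r10.
have mdr1 := measurable_tdiff mr1.
pose h t := Hs_sqnorm s Omega (slice r1 t).
have hE t : (h t = \int[leb]_x (r1 (x, t) ^+ 2)%:E + \int[leb2]_z (tdiff r1 (z, t) ^+ 2)%:E)%E.
  by rewrite /h /Hs_sqnorm FRe_sqr//; exact: measurable_slice.
have mh : measurable_fun setT h.
  rewrite (_ : h = fun t => (\int[leb]_x (r1 (x, t) ^+ 2)%:E +
      \int[leb2]_z (tdiff r1 (z, t) ^+ 2)%:E)%E); last exact/funext/hE.
  by apply: emeasurable_funD; exact: measurable_int_sqrX.
have h0 t : (0 <= h t)%E.
  by rewrite hE adde_ge0//; apply: integral_ge0 => x _; rewrite lee_fin sqr_ge0.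
(* The norm is defined through fine, so the integral of its square controls that
   of h only because h is finite at almost every time. *)
have hoo : (\int[mu]_t h t < +oo)%E.
  apply: le_lt_trans rho2.
  rewrite [leRHS]integral_mkcond le_eqVlt; apply/orP; left; apply/eqP.
  apply: ae_eq_integral => //.
    rewrite (_ : _ \_ _ = (EFin \o fine \o h) \_ `]0, T[%classic).
      apply/(measurable_restrictT _ _).1 => //; apply: measurable_funTS.
      by apply/measurable_EFinP; apply: measurableT_comp.
    apply/funext => t; rewrite !patchE; case: ifPn => // tT.
    rewrite /= /Hs_norm -s1E; last by move: tT; rewrite mem_setE.
    by rewrite sqr_sqrtr// fine_ge0//; exact: h0.
  apply: aeS rhoH => t rhoHt _; rewrite patchE; case: ifPn => tT.
    have tT' : t \in `]0, T[ by move: tT; rewrite mem_setE.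
    rewrite /Hs_norm sqr_sqrtr; last by rewrite fine_ge0// -s1E//; exact: h0.
    rewrite fineK ?/h ?s1E// ge0_fin_numE; first by case: (rhoHt tT').
    by rewrite -s1E//; exact: h0.
  rewrite hE !integral0_eq ?adde0// => x _.
    by rewrite /tdiff s10 /wdiff ?subrr ?mul0r ?expr0n//; rewrite mem_setE in tT.
  by rewrite r10 ?expr0n//; rewrite mem_setE in tT.
have I1 : (\int[leb]_x \int[mu]_t (r1 (x, t) ^+ 2)%:E < +oo)%E.
  rewrite fubini_sqr//.
  apply: le_lt_trans hoo; apply: ge0_le_integral => //.
  - by move=> t _; apply: integral_ge0 => x _; rewrite lee_fin sqr_ge0.
  - exact: measurable_int_sqrX.
  - by move=> t _; rewrite hE leeDl// integral_ge0// => z _; rewrite lee_fin sqr_ge0.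
have I2 : (\int[mu]_t \int[leb2]_z (tdiff r1 (z, t) ^+ 2)%:E < +oo)%E.
  apply: le_lt_trans hoo; apply: ge0_le_integral => //.
  - by move=> t _; apply: integral_ge0 => x _; rewrite lee_fin sqr_ge0.
  - exact: measurable_int_sqrX.
  - by move=> t _; rewrite hE leeDr// integral_ge0// => z _; rewrite lee_fin sqr_ge0.
pose e x := (\int[mu]_t (r1 (x, t) ^+ 2)%:E)%E.
have me : measurable_fun setT e.
  exact: measurable_int_sqrY.
have e0 x : (0 <= e x)%E by apply: integral_ge0 => t _; rewrite lee_fin sqr_ge0.
pose A := [set x | (e x < +oo)%E].
have mA : measurable A by rewrite -[A]setTI; exact: emeasurable_fun_infty_o.
have aeA : {ae leb, forall x, A x}.
  have : leb.-integrable setT e.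
    by apply/integrableP; split => //; under eq_integral do rewrite gee0_abs//.
  by move/integrable_ae => /(_ measurableT); apply: filterS => x /(_ I); rewrite ge0_fin_numE.
pose r := r1 \_ (A `*` setT).
have rE x t : A x -> r (x, t) = r1 (x, t).
  by move=> Ax; rewrite /r patchE mem_set.
have rNE x t : ~ A x -> r (x, t) = 0.
  by move=> Ax; rewrite /r patchE memNset//= => -[].
have mr : measurable_fun setT r.
  apply/(measurable_restrictT _ _).1; first exact: measurableX.
  exact: measurable_funTS.
have Lrx x : L2 mu (fun t => r (x, t)).
  split; first exact: measurableT_comp.
  have [Ax|Ax] := pselect (A x).
    by under eq_integral do rewrite rE//.
  by under eq_integral do rewrite rNE// expr0n/=; rewrite integral0.
exists r; split.
- split; [exact: mr|exact: Lrx|].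
  apply: le_lt_trans I1; apply: ge0_le_integral => //.
  + by move=> t _; apply: integral_ge0 => x _; rewrite lee_fin sqr_ge0.
  + exact: measurable_int_sqrY.
  + move=> x _; have [Ax|Ax] := pselect (A x).
      by rewrite le_eqVlt; apply/orP; left; apply/eqP; apply: eq_integral => t _; rewrite rE.
    by rewrite integral0_eq ?e0// => t _; rewrite rNE// expr0n.
- split; first exact: measurable_tdiff.
    move=> z; rewrite (_ : (fun t => _) =
        (fun t => Num.sqrt (weight s Omega z) * (r (z.1, t) - r (z.2, t)))).
      by apply: L2Z; exact: L2B.
    by apply/funext => t; rewrite /tdiff /wdiff mulrC.
  rewrite fubini_sqr; last exact: measurable_tdiff.
  apply: le_lt_trans I2; rewrite le_eqVlt; apply/orP; left; apply/eqP; apply: eq_integral => t _.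
  apply: ae_eq_integral => //.
  + apply/measurable_EFinP; apply: measurable_funX.
    exact: (measurable_wdiff s mO (measurable_slice t mr)).
  + apply/measurable_EFinP; apply: measurable_funX.
    exact: (measurable_wdiff s mO (measurable_slice t mr1)).
  + have : {ae leb2, forall z, delta (slice r t) z = delta (slice r1 t) z}.
      by apply: ae_wdiff; apply: filterS aeA => x; exact: rE.
    by apply: filterS => z; rewrite /tdiff /= => ->.
- move=> x t tT; have [Ax|Ax] := pselect (A x); first by rewrite rE// r10.
  by rewrite rNE.
- by apply: filterS aeA => x Ax t tT; rewrite rE// r1E.
Qed.

End representative.

(** * Bounded representatives of the data, and time averages in H^s *)
Section clamp.
Context d (X : measurableType d) (R : realType) (m : {measure set X -> \bar R}).
Implicit Types (f : X -> R) (M : R).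

(** Truncating an essentially bounded datum at its sup norm changes it on a null
    set only, and makes the bound hold everywhere. *)
Definition clamp M f x : R := Num.max (- M) (Num.min M (f x)).

Lemma measurable_clamp M f : measurable_fun setT f -> measurable_fun setT (clamp M f).
Proof. by move=> mf; apply: measurable_maxr => //; exact: measurable_minr. Qed.

Lemma clamp_bound M f x : 0 <= M -> `|clamp M f x| <= M.
Proof.
move=> M0; rewrite ler_norml /clamp le_max lexx /= ge_max ge_min lexx andbT.
by rewrite (le_trans _ M0)// oppr_le0.
Qed.

Lemma clamp_id M f x : `|f x| <= M -> clamp M f x = f x.
Proof. by rewrite ler_norml => /andP[h1 h2]; rewrite /clamp min_r// max_r. Qed.

Lemma clamp_le M f x : 0 <= M -> `|clamp M f x| <= `|f x|.
Proof.
move=> M0; rewrite /clamp; have [fM|fM] := leP `|f x| M.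
  by rewrite -/(clamp M f x) clamp_id.
by apply: le_trans (ltW fM); exact: clamp_bound.
Qed.

Lemma Lfun_infty_bound f : f \in Lfun m +oo%E ->
  exists M : R, [/\ 0 <= M, ('N[m]_+oo[EFin \o f] = M%:E)%E, measurable_fun setT f &
    {ae m, forall x, `|f x| <= M}].
Proof.
rewrite inE => /andP[]; rewrite !inE /= => mf foo.
have N0 := Lnorm_ge0 m +oo%E (EFin \o f).
have Nfin : ('N[m]_+oo[EFin \o f])%E \is a fin_num by rewrite ge0_fin_numE.
exists (fine ('N[m]_+oo[EFin \o f])%E); split => //.
- exact: fine_ge0.
- by rewrite fineK.
(* The essential supremum is only meaningful on a space of positive measure; on a
   null space every property holds almost everywhere. *)
- have [m0|m0] := ltP 0%E (m [set: X]).
    apply: aeS (ess_sup_ge m (abse \o (EFin \o f))) => x /= fx.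
    rewrite -lee_fin fineK//; apply: le_trans fx _.
    by rewrite unlock m0.
  exists setT; split => //.
  by apply/eqP; rewrite eq_le m0 measure_ge0.
Qed.

End clamp.

Lemma ae_Rintegral d (X : measurableType d) (R : realType)
    (m : {measure set X -> \bar R}) (f g : X -> R) :
  measurable_fun setT f -> measurable_fun setT g -> {ae m, forall x, f x = g x} ->
  \int[m]_x f x = \int[m]_x g x.
Proof.
move=> mf mg fg; congr fine; apply: ae_eq_integral => //.
- exact/measurable_EFinP.
- exact/measurable_EFinP.
- by apply: aeS fg => x -> _.
Qed.

Section time_average.
Context (R : realType) (N : nat) (s : R) (Omega : set 'rV[R]_N) (T : R).
Hypotheses (mO : measurable Omega) (s_ge0 : 0 <= s).
Local Notation leb := (lebesgue_rV R N).
Local Notation leb2 := (@lebesgue_pair R N).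
Local Notation mu := (@lebesgue_measure R).
Local Notation delta := (wdiff s Omega).
Local Notation delta_t := (tdiff s Omega).
Implicit Types (r f g : 'rV[R]_N * R -> R) (w v psi : 'rV[R]_N -> R).

Lemma ae_fst (P : 'rV[R]_N -> Prop) : {ae leb, forall x, P x} ->
  {ae space_time R N, forall z : 'rV[R]_N * R, P z.1}.
Proof.
move=> [B [mB B0 PB]].
exists (B `*` setT); split; first exact: measurableX.
  have E A C : measurable A -> measurable C -> (space_time R N (A `*` C) = leb A * mu C)%E.
    by move=> mA mC; exact: product_measure1E.
  by apply: (etrans (E _ _ mB measurableT)); rewrite B0 mul0e.
by move=> z /= nP; split => //; exact: PB.
Qed.

(** Averaging in time commutes with differences in space. *)
Lemma wdiff_avg r k : L2_sections leb mu r -> L2 mu k ->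
  delta (avg mu r k) = avg mu (delta_t r) k.
Proof.
move=> Lr Lk; have [_ Lrx _] := Lr; apply/funext => z.
rewrite /wdiff !avgE -ipBl// mulrC -ipZl//; last exact: L2B.
apply: eq_Rintegral => t _; congr (_ * _).
by rewrite /tdiff /wdiff /slice /= mulrC.
Qed.

Lemma Hs_avg r k : L2_sections leb mu r -> L2_sections leb2 mu (delta_t r) ->
  L2 mu k -> Hs s Omega (avg mu r k).
Proof.
move=> Lr Ldr Lk; apply/(HsP mO s_ge0); split; first exact: L2_avg.
by rewrite wdiff_avg//; exact: L2_avg.
Qed.

(** A time average of a curve in L^2(0,T;H^s) is in H^s, with a squared norm
    controlled by the squared norm of the kernel. *)
Lemma Hs_form_avg r k : L2_sections leb mu r -> L2_sections leb2 mu (delta_t r) ->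
  L2 mu k -> Hs_form s Omega (avg mu r k) (avg mu r k) <=
    ip mu k k * (energy leb mu r + energy leb2 mu (delta_t r)).
Proof.
move=> Lr Ldr Lk; rewrite mulrDr; apply: lerD; first exact: ip_avg_le.
by rewrite wdiff_avg//; exact: ip_avg_le.
Qed.

(** The ramp equals 1 at all negative times; as a kernel it is restricted to
    (0,T), which leaves it bounded with bounded support. *)
Definition cutoff (k : R -> R) : R -> R := k \_ `]0, T[%classic.

Lemma bounded_cutoff_L2 (k : R -> R) : measurable_fun setT k -> (exists M, forall t, `|k t| <= M) ->
  L2 mu (cutoff k).
Proof.
move=> mk [M kM]; split.
  apply/(measurable_restrictT _ _).1; first exact: measurable_itv.
  exact: measurable_funTS.
apply: (@le_lt_trans _ _ (\int[mu]_(t in `]0%R, T[) (M ^+ 2)%:E)%E).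
  rewrite [leRHS]integral_mkcond; apply: ge0_le_integral => //=.
  - by move=> t _; rewrite lee_fin sqr_ge0.
  - apply/measurable_EFinP; apply: measurable_funX.
    apply/(measurable_restrictT _ _).1; first exact: measurable_itv.
    exact: measurable_funTS.
  - apply/(measurable_restrictT _ _).1; first exact: measurable_itv.
    exact: measurable_cst.
  - move=> t _; rewrite /cutoff !patchE; case: ifPn => // _; last by rewrite expr0n.
    rewrite lee_fin -[leLHS]real_normK ?num_real// lerXn2r ?nnegrE//.
    exact: le_trans (kM t).
rewrite integral_cst//= lebesgue_measure_itv/= lte_fin.
by case: ifP => _; rewrite ?mule0// -EFinM ltry.
Qed.

End time_average.

(** * The weak equation tested with products *)
Section averaged_equation.
Context (R : realType) (N : nat) (s : R) (Omega : set 'rV[R]_N) (T : R).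
Hypotheses (mO : measurable Omega) (s_ge0 : 0 <= s).
Local Notation leb := (lebesgue_rV R N).
Local Notation leb2 := (@lebesgue_pair R N).
Local Notation mu := (@lebesgue_measure R).
Local Notation delta := (wdiff s Omega).
Local Notation delta_t := (tdiff s Omega).
Implicit Types (r f g : 'rV[R]_N * R -> R) (w v psi : 'rV[R]_N -> R).

Lemma cutoffE (k : R -> R) t : t \in `]0, T[ -> cutoff T k t = k t.
Proof. by move=> tT; rewrite /cutoff patchE mem_setE tT. Qed.

Lemma cutoffN (k : R -> R) t : t \notin `]0, T[ -> cutoff T k t = 0.
Proof. by move=> tT; rewrite /cutoff patchE mem_setE (negbTE tT). Qed.

Lemma L2_cutoff_cst (M : R) : L2 mu (cutoff T (cst M)).
Proof. by apply: bounded_cutoff_L2 => //; exists `|M|. Qed.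

Lemma L2_bounded_section f (M : R) x : measurable_fun setT f ->
  (forall z, `|f z| <= M) -> (forall x t, t \notin `]0, T[ -> f (x, t) = 0) ->
  L2 mu (fun t => f (x, t)).
Proof.
move=> mf fM f0; apply: L2_le (L2_cutoff_cst M); first exact: measurableT_comp.
move=> t; have [tT|tT] := boolP (t \in `]0, T[).
  by rewrite cutoffE//=; apply: le_trans (ler_norm _); exact: fM.
by rewrite f0// normr0.
Qed.

Lemma L2_sections_bounded f (M : R) : (leb Omega < +oo)%E -> measurable_fun setT f ->
  (forall z, `|f z| <= M) -> (forall x t, t \notin `]0, T[ -> f (x, t) = 0) ->
  (forall x t, ~ Omega x -> f (x, t) = 0) -> L2_sections leb mu f.
Proof.
move=> Ofin mf fM f0 fO; have Lfx x := L2_bounded_section x mf fM f0.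
split => //; pose c := ip mu (cutoff T (cst M)) (cutoff T (cst M)).
apply: (@le_lt_trans _ _ (\int[leb]_(x in Omega) c%:E)%E); last first.
  rewrite integral_cst//; apply: lte_mul_pinfty => //.
  by rewrite lee_fin ipff_ge0.
rewrite [leRHS]integral_mkcond; apply: ge0_le_integral => //.
- by move=> x _; apply: integral_ge0 => t _; rewrite lee_fin sqr_ge0.
- exact: measurable_int_sqrY.
- by apply/(measurable_restrictT _ _).1 => //; exact: measurable_cst.
- move=> x _; rewrite patchE; case: ifPn => xO; last first.
    by rewrite integral0_eq// => t _; rewrite fO ?expr0n// => Ox; move: xO; rewrite mem_set.
  rewrite -ip_sqr// lee_fin; apply: le_ip => //; try exact: L2_cutoff_cst.
  move=> t; have [tT|tT] := boolP (t \in `]0, T[); last first.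
    by rewrite f0// mul0r cutoffN// mul0r.
  rewrite cutoffE//= -!expr2 -[leLHS]real_normK ?num_real// lerXn2r ?nnegrE//.
  exact: le_trans (fM (x, t)).
Qed.

(** For data carried by the unbounded exterior of Omega: square integrability in
    space-time comes from the dominating function, while the bound gives that of
    every time line. *)
Lemma L2_sections_dominated f g (M : R) : measurable_fun setT f ->
  (forall z, `|f z| <= M) -> (forall x t, t \notin `]0, T[ -> f (x, t) = 0) ->
  L2 (space_time R N) g -> (forall z, `|f z| <= `|g z|) -> L2_sections leb mu f.
Proof.
move=> mf fM f0 Lg fg; split=> [//|x|]; first exact: L2_bounded_section fM f0.
have [_ f2] := @L2_le _ _ _ (space_time R N) _ _ mf fg Lg.
have := @fubini_tonelli1 _ _ _ _ _ leb mu (fun z => (f z ^+ 2)%:E).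
rewrite /fubini_F => <-//; first by apply/measurable_EFinP; exact: measurable_funX.
by move=> z; rewrite lee_fin sqr_ge0.
Qed.

Variables (f g : 'rV[R]_N * R -> R) (rho0 : 'rV[R]_N -> R) (rho : 'rV[R]_N * R -> R).
Hypothesis rho_sol : weak_solution s Omega T f g rho0 rho.
Variables (r f1 g1 : 'rV[R]_N * R -> R) (v0 : 'rV[R]_N -> R).
Hypotheses (Lr : L2_sections leb mu r) (Ldr : L2_sections leb2 mu (delta_t r)).
Hypothesis r_off : forall x t, t \notin `]0, T[ -> r (x, t) = 0.
Hypothesis rE : {ae leb, forall x, forall t, t \in `]0, T[ -> r (x, t) = rho (x, t)}.
Hypotheses (Lf1 : L2_sections leb mu f1) (Lg1 : L2_sections leb mu g1) (Lv0 : L2 leb v0).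
Hypothesis mfQ : measurable_fun setT (f \_ (Qcyl Omega T)).
Hypothesis mgS : measurable_fun setT (g \_ (Sigma Omega T)).
Hypothesis mv : measurable_fun setT (rho0 \_ Omega).
Hypothesis f1E : {ae space_time R N, forall z, (f \_ (Qcyl Omega T)) z = f1 z}.
Hypothesis g1E : {ae space_time R N, forall z, (g \_ (Sigma Omega T)) z = g1 z}.
Hypothesis v0E : {ae leb, forall x, (rho0 \_ Omega) x = v0 x}.

Variables (a b : R) (psi : 'rV[R]_N -> R).
Hypotheses (a_ge0 : 0 <= a) (ab : a < b) (bT : b <= T) (Hpsi : Hs s Omega psi).

Let k := cutoff T (ramp a b).
Let Lpsi : L2 leb psi. Proof. by case/(HsP mO s_ge0) : Hpsi. Qed.
Let Ldpsi : L2 leb2 (delta psi). Proof. by case/(HsP mO s_ge0) : Hpsi. Qed.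
Let Lk : L2 mu k.
Proof.
apply: bounded_cutoff_L2; first exact: measurable_ramp.
by exists 1 => t; rewrite ger0_norm ?ramp_le1 ?ramp_ge0.
Qed.

Let mrho1 : measurable_fun setT (rho \_ ([set: 'rV[R]_N] `*` `]0, T[%classic)).
Proof.
have [[mrho _ _] _] := rho_sol.
by apply/(measurable_restrictT _ _).1 => //; exact: measurableX.
Qed.

Let mrhot t : t \in `]0, T[ -> measurable_fun setT (slice rho t).
Proof.
move=> tT; rewrite (_ : slice rho t = slice (rho \_ ([set: 'rV[R]_N] `*` `]0, T[%classic)) t).
  exact: measurable_slice.
by apply/funext => x; rewrite /slice patchE mem_set.
Qed.

Let mrt t : measurable_fun setT (slice r t).
Proof. by apply: measurable_slice; case: Lr. Qed.

Let rtE t : t \in `]0, T[ -> {ae leb, forall x, slice rho t x = slice r t x}.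
Proof. by move=> tT; apply: aeS rE => x rx; rewrite /slice rx. Qed.

(** The minus sign of the weak formulation cancels that of the slope of the
    ramp. *)
Lemma weak_time_term :
  - (\int[mu]_(t in `]0, T[) (test_fun_t Omega a b psi t (slice rho t))) =
  (b - a)^-1 * ip leb (avg mu r (cell a b)) (psi \_ Omega).
Proof.
have LpO := L2_restrict mO Lpsi.
have Lcell := L2_cell a b.
transitivity (- \int[mu]_t (\int[leb]_x (r (x, t) * ((psi \_ Omega) x * cutoff T (dramp a b) t)))).
  congr (- _); rewrite Rintegral_mkcond; apply: eq_Rintegral => t _.
  rewrite patchE mem_setE; case: ifPn => tT; last first.
    rewrite cutoffN//; under eq_Rintegral do rewrite !mulr0.
    by rewrite Rintegral_cst// mul0r.
  rewrite cutoffE// /test_fun_t pairingE.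
  have mpsi : measurable_fun setT (psi \_ Omega) by case: LpO.
  transitivity (\int[leb]_x (slice rho t x * ((psi \_ Omega) x * dramp a b t))).
    apply: eq_Rintegral => x _; rewrite !patchE; case: ifP => //.
    by rewrite mul0r.
  apply: ae_Rintegral.
  - by apply: measurable_funM; [exact: mrhot|exact: measurable_funM].
  - by apply: measurable_funM; [exact: mrt|exact: measurable_funM].
  - by apply: aeS (rtE tT) => x ->.
have Lcut : L2 mu (cutoff T (dramp a b)).
  apply: bounded_cutoff_L2; first exact: measurable_dramp.
  exists (b - a)^-1 => t; rewrite /dramp cellE; case: (_ && _).
    by rewrite mulr1 normrN ger0_norm// invr_ge0 subr_ge0 ltW.
  by rewrite mulr0 normr0 invr_ge0 subr_ge0 ltW.
rewrite (Rintegral_avg2 Lr Lcut LpO).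
have -> : avg mu r (cutoff T (dramp a b)) = fun x => - (b - a)^-1 * avg mu r (cell a b) x.
  apply/funext => x; rewrite -(avgZ _ x Lr (L2_cell a b)); congr (_ x); apply: eq_avg => y t.
  have [tT|tT] := boolP (t \in `]0, T[); first by rewrite cutoffE.
  by rewrite r_off// !mul0r.
by rewrite ipZl ?mulNr ?opprK//; exact: L2_avg.
Qed.

Lemma weak_energy_term :
  \int[mu]_(t in `]0, T[)
    FR s Omega (slice rho t) (slice (test_fun a b psi) t) =
  ip leb2 (delta (avg mu r k)) (delta psi).
Proof.
rewrite (wdiff_avg s Omega Lr Lk) -(Rintegral_avg2 Ldr Lk Ldpsi) Rintegral_mkcond.
apply: eq_Rintegral => t _; rewrite patchE mem_setE; case: ifPn => tT; last first.
  rewrite /k cutoffN//; under eq_Rintegral do rewrite !mulr0.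
  by rewrite Rintegral_cst// mul0r.
rewrite FR_ip//; last 2 first.
- exact: mrhot.
- by apply: (@measurable_funM _ _ _ _ psi (cst (ramp a b t))) => //; case: Lpsi.
have Et : delta (slice (test_fun a b psi) t) = fun z => delta psi z * k t.
  by apply/funext => z; rewrite /wdiff /slice /test_fun /k cutoffE//=; ring.
rewrite Et; apply: ae_Rintegral.
- apply: measurable_funM; first by apply: measurable_wdiff => //; exact: mrhot.
  by apply: measurable_funM => //; case: Ldpsi.
- apply: measurable_funM; first by apply: (measurable_wdiff s mO (mrt t)).
  by apply: measurable_funM => //; case: Ldpsi.
- by apply: aeS (ae_wdiff s Omega (rtE tT)) => z /= ->.
Qed.

Lemma Rintegral_cylinder (B : set 'rV[R]_N) (h h1 : 'rV[R]_N * R -> R) :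
  measurable B -> L2_sections leb mu h1 ->
  measurable_fun setT (h \_ (B `*` `]0, T[%classic)) ->
  {ae space_time R N, forall z : 'rV[R]_N * R, (B `*` `]0, T[%classic) z -> h z = h1 z} ->
  \int[space_time R N]_(z in B `*` `]0, T[%classic) (h z * test_fun a b psi z) =
  ip leb (avg mu h1 k) (psi \_ B).
Proof.
move=> mB Lh1 mh hh1; have LpB := L2_restrict mB Lpsi.
rewrite -Rintegral_avg// Rintegral_mkcond; apply: ae_Rintegral.
- rewrite (_ : _ \_ _ = fun z => (h \_ (B `*` `]0, T[%classic)) z * test_fun a b psi z).
    apply: measurable_funM => //; apply: measurable_funM.
      by apply: measurableT_comp; [case: Lpsi|exact: measurable_fst].
    by apply: measurableT_comp; [exact: measurable_ramp|exact: measurable_snd].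
  by apply/funext => z; rewrite !patchE; case: ifP => //; rewrite mul0r.
- apply: measurable_funM; first by case: Lh1.
  apply: measurable_funM.
    by apply: measurableT_comp; [case: LpB|exact: measurable_fst].
  by apply: measurableT_comp; [case: Lk|exact: measurable_snd].
- apply: aeS hh1 => -[x t] hz; rewrite !patchE /=.
  case: ifPn => zB.
    have [/= xB tT] : (B `*` `]0, T[%classic) (x, t) by move: zB; rewrite inE.
    by rewrite hz// mem_set// /test_fun /k cutoffE.
  have [xB|xB] := boolP (x \in B); last by rewrite mul0r mulr0.
  rewrite /k cutoffN ?mulr0//; apply/negP => tT; move/negP: zB; apply.
  by rewrite mem_set//; split => //; move: xB; rewrite inE.
Qed.

(** Fubini in each term of the weak equation: the time integration is carried out
    first, and leaves an equation in x for weighted time averages.  There is no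
    error term. *)
Lemma averaged_identity :
  (b - a)^-1 * ip leb (avg mu r (cell a b)) (psi \_ Omega)
  + ip leb2 (delta (avg mu r k)) (delta psi)
  + ip leb (avg mu r k) (psi \_ (~` Omega)) =
  ip leb (avg mu f1 k) (psi \_ Omega)
  + ip leb (avg mu g1 k) (psi \_ (~` Omega))
  + ip leb v0 (psi \_ Omega).
Proof.
have [_ /(_ (test_fun a b psi) (test_fun_t Omega a b psi) psi)] := rho_sol.
have tHQ : HQ s Omega T (test_fun a b psi) by exact: test_fun_HQ.
have tD : time_derivative s Omega T (test_fun a b psi) (test_fun_t Omega a b psi).
  exact: test_fun_time_derivative.
have tV : value_at Omega T (test_fun a b psi) 0 psi by apply: (test_fun_value0 (s := s)).
move=> /(_ tHQ tD tV).
rewrite weak_time_term weak_energy_term /Sigma /Qcyl.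
have mOc := measurableC mO.
rewrite (@Rintegral_cylinder _ _ r)//; last 2 first.
- rewrite (_ : _ \_ _ = (rho \_ ([set: 'rV[R]_N] `*` `]0, T[%classic)) \_ (~` Omega `*` `]0, T[%classic)).
    apply/(measurable_restrictT _ _).1; first exact: measurableX.
    exact: measurable_funTS.
  apply/funext => z; rewrite !patchE; case: ifPn => // /set_mem [_ zT].
  by rewrite mem_set.
- by apply: (@aeS _ _ _ (space_time R N) _ _ _ (ae_fst rE)) => -[x t] /= rx [_ tT]; rewrite rx.
rewrite (@Rintegral_cylinder _ _ f1)//; last first.
  by apply: (@aeS _ _ _ (space_time R N) _ _ _ f1E) => z <- zQ; rewrite patchE mem_set.
rewrite (@Rintegral_cylinder _ _ g1)//; last first.
  by apply: (@aeS _ _ _ (space_time R N) _ _ _ g1E) => z <- zQ; rewrite patchE mem_set.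
move=> ->; congr (_ + _).
rewrite Rintegral_mkcond.
have LpO := L2_restrict mO Lpsi.
have mpO : measurable_fun setT (psi \_ Omega) by case: LpO.
transitivity (\int[leb]_x ((rho0 \_ Omega) x * (psi \_ Omega) x)).
  by apply: eq_Rintegral => x _; rewrite !patchE; case: ifP => //; rewrite mul0r.
apply: ae_Rintegral.
- exact: measurable_funM.
- by apply: measurable_funM => //; case: Lv0.
- by apply: aeS v0E => x ->.
Qed.

End averaged_equation.

(** * Differences of ramps *)
Section kernels.
Context (R : realType) (T : R).
Local Notation mu := (@lebesgue_measure R).
Implicit Types (a b c h t : R).

Lemma lebesgue_cell a b : a <= b -> mu `[a, b[%classic = (b - a)%:E.
Proof.
rewrite le_eqVlt => /predU1P[->|ab]; first by rewrite set_itvco0 ?measure0 ?subrr.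
by rewrite lebesgue_measure_itv/= lte_fin ab.
Qed.

Lemma Rintegral_cell a b : a <= b -> \int[mu]_t cell a b t = b - a.
Proof.
move=> ab; rewrite /Rintegral /cell integral_indic// setIT.
by rewrite -[RHS]/(fine (b - a)%:E) -lebesgue_cell.
Qed.

Lemma ip_cell a b : a <= b -> ip mu (cell a b) (cell a b) = b - a.
Proof.
move=> ab; rewrite -Rintegral_cell//; apply: eq_Rintegral => t _.
by rewrite cellE; case: (_ && _); rewrite ?mulr1 ?mulr0.
Qed.

(** What the ramp lacks to be the step that falls from 1 to 0 at b. *)
Definition tooth a b t : R := cell a b t * ((t - a) / (b - a)).

Lemma tooth_ge0 a b t : a < b -> 0 <= tooth a b t.
Proof.
move=> ab; rewrite /tooth cellE; case: (boolP (_ && _)) => [/andP[ta _]|_]; last by rewrite mul0r.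
by rewrite mul1r divr_ge0// subr_ge0// ltW.
Qed.

Lemma tooth_le a b t : a < b -> tooth a b t <= cell a b t.
Proof.
move=> ab; rewrite /tooth cellE; case: (boolP (_ && _)) => [/andP[ta tb]|_]; last by rewrite mul0r.
by rewrite mul1r ler_pdivrMr ?subr_gt0// mul1r lerD2r ltW.
Qed.

Lemma measurable_tooth a b : measurable_fun setT (tooth a b).
Proof.
apply: measurable_funM; first exact: measurable_indic.
by apply: measurable_funM => //; exact: measurable_funB.
Qed.

Lemma L2_tooth a b : a < b -> L2 mu (tooth a b).
Proof.
move=> ab; apply: L2_le (L2_cell a b); first exact: measurable_tooth.
move=> t; rewrite !ger0_norm; [exact: tooth_le| |exact: tooth_ge0].
by rewrite cellE.
Qed.

Lemma ip_tooth_le a b : a < b -> ip mu (tooth a b) (tooth a b) <= b - a.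
Proof.
move=> ab; rewrite -(ip_cell (ltW ab)); have L1 := L2_tooth ab; have L3 := L2_cell a b.
by apply: le_ip => // t; apply: ler_pM; rewrite ?tooth_ge0 ?tooth_le.
Qed.

Lemma rampE a b t : a < b -> ramp a b t = (t < b)%R%:R - tooth a b t.
Proof.
move=> ab; rewrite /tooth cellE; have [bt|tb] := leP b t.
  by rewrite ramp_eq0// andbF mul0r subr0.
have [ta|ta] := leP a t; last by rewrite ramp_eq1 ?ltW//= mul0r subr0.
rewrite ramp_mid ?ta ?ltW//= mul1r.
by field; rewrite subr_eq0 gt_eqF.
Qed.

Lemma integrable_cell a b : mu.-integrable setT (EFin \o cell a b).
Proof.
have := L2_mul_integrable (L2_cell a b) (L2_cell a b); congr (_.-integrable _ _).
apply/funext => t /=; rewrite cellE.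
by case: (_ && _); rewrite ?mulr1 ?mulr0.
Qed.

Lemma integrable_tooth a b : a < b -> mu.-integrable setT (EFin \o tooth a b).
Proof.
move=> ab; apply: le_integrable (integrable_cell a b) => //.
  by apply/measurable_EFinP; exact: measurable_tooth.
move=> t _ /=; rewrite lee_fin !ger0_norm; [exact: tooth_le| |exact: tooth_ge0].
by rewrite cellE.
Qed.

Lemma Rintegral_tooth a b : a < b -> \int[mu]_t tooth a b t = (b - a) / 2.
Proof.
move=> ab; have ba : b - a != 0 by rewrite subr_eq0 gt_eqF.
transitivity (\int[mu]_(t in `[a, b[) ((t - a) / (b - a))).
  rewrite [RHS]Rintegral_mkcond; apply: eq_Rintegral => t _.
  rewrite /tooth cellE patchE mem_setE in_itv /=.
  by case: (_ && _); rewrite ?mul1r ?mul0r.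
have cf : continuous (fun t : R => (t - a) / (b - a)).
  by move=> t; apply: cvgMl; apply: cvgB; [exact: cvg_id|exact: cvg_cst].
have If : mu.-integrable `[a, b] (EFin \o (fun t : R => (t - a) / (b - a))).
  apply: continuous_compact_integrable; first exact: segment_compact.
  exact: continuous_subspaceT.
rewrite Rintegral_itv_bndo_bndc; last first.
  by apply: integrableS If => //; exact: subset_itv_co_cc.
pose F (t : R) := (2 * (b - a))^-1 * (t - a) ^+ 2.
have DF (t : R) : is_derive t (1 : R) F ((t - a) / (b - a)).
  have H : is_derive t (1 : R) ((2 * (b - a))^-1 \*: ((id - cst a : R -> R) ^+ 2))
      ((2 * (b - a))^-1 *: ((2%:R * (t - a) ^+ 1) *: (1 - 0 : R))).
    by apply: is_deriveZ; apply: is_deriveX.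
  move: H; congr is_derive; rewrite /GRing.scale /= subr0 mulr1 expr1.
  by field.
have cF : continuous F.
  move=> t; apply/differentiable_continuous; rewrite -derivable1_diffP.
  by case: (DF t).
rewrite /Rintegral (@continuous_FTC2 _ (fun t => (t - a) / (b - a)) F)//.
- rewrite /F /= subrr expr0n /= mulr0 subr0.
  by field.
- exact: continuous_subspaceT.
- split; first by move=> t _; case: (DF t).
    by apply: cvg_at_right_filter; exact: cF.
  by apply: cvg_at_left_filter; exact: cF.
- by move=> t _; rewrite derive1E; case: (DF t).
Qed.

(** The time profile of the difference between the equations for two windows at
    distance h.  It is close to the indicator of [b - h,b[ when b - a is small. *)
Definition trapeze a b h t : R := ramp a b t - ramp (a - h) (b - h) t.

Lemma trapezeE a b h t : a < b -> 0 <= h ->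
  trapeze a b h t = cell (b - h) b t - (tooth a b t - tooth (a - h) (b - h) t).
Proof.
move=> ab h0; rewrite /trapeze !rampE ?ltrD2r// cellE.
rewrite (_ : (b - h <= t < b)%R%:R = (t < b)%R%:R - (t < b - h)%R%:R :> R); first by ring.
have [tb|bt] := ltP t b; rewrite ?andbT ?andbF.
  by have [_|_] := leP (b - h) t; rewrite ?subr0 ?subrr.
by rewrite ltNge (le_trans _ bt) ?subr0// lerBlDr lerDl.
Qed.

Lemma trapeze_ge0 a b h t : a < b -> 0 <= h -> 0 <= trapeze a b h t.
Proof.
move=> ab h0; rewrite /trapeze subr_ge0 /ramp.
have -> : b - h - (a - h) = b - a by ring.
have le : (b - h - t) / (b - a) <= (b - t) / (b - a).
  apply: ler_wpM2r; first by rewrite invr_ge0 subr_ge0 ltW.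
  by rewrite lerD2r lerBlDr lerDl.
by rewrite ge_max le_max lexx /= le_max; apply/orP; right; rewrite le_min ge_min lexx /= ge_min le orbT.
Qed.

(** Both sides are the same signed sum of the indicators of the four half-lines
    ending at a - h, a, b - h and b.  The identity exchanges two windows of length b - a at distance h
    for two windows of length h at distance b - a. *)
Lemma cellB a b h t : a <= b -> 0 <= h ->
  cell a b t - cell (a - h) (b - h) t = cell (b - h) b t - cell (a - h) a t.
Proof.
move=> ab h0; suff : cell a b t + cell (a - h) a t = cell (b - h) b t + cell (a - h) (b - h) t.
  by move=> E; apply/eqP; rewrite subr_eq addrAC eq_sym subr_eq E.
have ah : a - h <= a by rewrite lerBlDr lerDl.
have bh : b - h <= b by rewrite lerBlDr lerDl.
have abh : a - h <= b - h by rewrite lerD2r.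
rewrite !cellE.
have [ta|ta] := leP a t; have [tb|tb] := ltP t b; have [tah|tah] := leP (a - h) t;
  have [tbh|tbh] := leP (b - h) t => //=; rewrite ?addr0 ?add0r//; exfalso; lra.
Qed.

Let trapeze_bound a b h t : R :=
  cell (b - h) b t - tooth a b t + tooth (a - h) (b - h) t.

Let trapeze_boundE a b h t : a < b -> 0 <= h -> trapeze a b h t = trapeze_bound a b h t.
Proof. by move=> ab h0; rewrite trapezeE// opprB addrA addrAC. Qed.

Let integrable_trapeze_bound a b h : a < b ->
  mu.-integrable setT (EFin \o trapeze_bound a b h).
Proof.
move=> ab; apply: integrable_EFinD; last by apply: integrable_tooth; rewrite ltrD2r.
exact: integrable_EFinB (integrable_cell (b - h) b) (integrable_tooth ab).
Qed.

Lemma integrable_cutoff_trapeze a b h : a < b -> 0 <= h ->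
  mu.-integrable setT (EFin \o cutoff T (trapeze a b h)).
Proof.
move=> ab h0; apply: le_integrable (integrable_trapeze_bound h ab) => //.
  apply/measurable_EFinP/(measurable_restrictT _ _).1; first exact: measurable_itv.
  by apply: measurable_funTS; apply: measurable_funB; exact: measurable_ramp.
move=> t _ /=; rewrite lee_fin /cutoff patchE; case: ifP => _.
  by rewrite trapeze_boundE.
by rewrite normr0.
Qed.

(** The integral over the whole line is h, as the two teeth have the same area;
    the trapeze being nonnegative, restricting it to (0,T) decreases it. *)
Lemma Rintegral_cutoff_trapeze a b h : a < b -> 0 <= h ->
  \int[mu]_t cutoff T (trapeze a b h) t <= h.
Proof.
move=> ab h0; have abh : a - h < b - h by rewrite ltrD2r.
have bhb : b - h <= b by rewrite lerBlDr lerDl.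
have kh : \int[mu]_t trapeze_bound a b h t = h.
  rewrite /trapeze_bound RintegralD//; last 2 first.
  - exact: integrable_EFinB (integrable_cell (b - h) b) (integrable_tooth ab).
  - exact: integrable_tooth.
  rewrite RintegralB//; last 2 first.
  - exact: integrable_cell.
  - exact: integrable_tooth.
  by rewrite Rintegral_cell// !Rintegral_tooth//; ring.
rewrite -[leRHS]kh; apply: le_Rintegral => //.
- exact: integrable_cutoff_trapeze.
- exact: integrable_trapeze_bound.
move=> t _; rewrite /cutoff patchE; case: ifP => _; first by rewrite trapeze_boundE.
by rewrite -trapeze_boundE// trapeze_ge0.
Qed.

End kernels.

(** * The discrete energy estimate *)
Lemma ip_avgB d1 d2 (X : measurableType d1) (Y : measurableType d2) (R : realType)
    (mX : {sigma_finite_measure set X -> \bar R})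
    (mY : {sigma_finite_measure set Y -> \bar R}) (G : X * Y -> R) (k1 k2 : Y -> R)
    (H : X -> R) :
  L2_sections mX mY G -> L2 mY k1 -> L2 mY k2 -> L2 mX H ->
  ip mX (avg mY G (fun y => k1 y - k2 y)) H =
  ip mX (avg mY G k1) H - ip mX (avg mY G k2) H.
Proof.
move=> LG L1 L2' LH; rewrite -ipBl//; [|exact: L2_avg..].
by congr (ip _ _ _); apply/funext => x; rewrite (avgB x LG).
Qed.

Lemma balance_sub (R : realType) (c A A' D D' Q Q' F F' G G' V : R) :
  c * A + D + Q = F + G + V -> c * A' + D' + Q' = F' + G' + V ->
  c * (A - A') + (D - D') + (Q - Q') = F - F' + (G - G') + 0.
Proof. by move=> e e'; rewrite addr0 -[F](addrK G) -[F + G](addrK V) -e; lra. Qed.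

Lemma balance_first (R : realType) (c A A' D D' Q Q' F F' G G' V : R) :
  A' = 0 -> D' = 0 -> Q' = 0 -> F' = 0 -> G' = 0 ->
  c * A + D + Q = F + G + V ->
  c * (A - A') + (D - D') + (Q - Q') = F - F' + (G - G') + 1 * V.
Proof. by move=> -> -> -> -> ->; rewrite !subr0 mul1r. Qed.

Lemma pos_part_contract (R : realType) (x y : R) :
  `|Num.max 0 x - Num.max 0 y| <= `|x - y|.
Proof.
have h1 := ler_norm (x - y); have h2 := ler_norm (y - x); rewrite distrC in h2.
by rewrite ler_norml; case: (leP 0 x) => Hx; case: (leP 0 y) => Hy; apply/andP; split; lra.
Qed.

Lemma pos_part_monotone (R : realType) (x y : R) :
  0 <= (x - y) * (Num.max 0 x - Num.max 0 y).
Proof.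
case: (leP 0 x) => Hx; case: (leP 0 y) => Hy.
- by rewrite -expr2 sqr_ge0.
- by apply: mulr_ge0; lra.
- by apply: mulr_le0; lra.
- by rewrite subrr mulr0.
Qed.

(** The algebra of one implicit Euler step of length d for means over windows of
    length h.  The balance contains the energy D, the exterior term Q and the data
    F, G and V, and the pairings eD and eQ of the teeth with the excess.  HX and HY
    bound the interior and exterior terms below by the squared norms Xa, Xb and Y
    of the excess, HXab is the convexity of the square, and Hyoung splits the
    pairings into the squared norm E of the average over the teeth, which is of
    order d, and the squared norm W of the excess. *)
Lemma discrete_energy_step (R : realType) (d h c pb pa D Q eD eQ F G V Xb Xa Xab Y E W l B : R) :
  0 < d -> 0 < h ->
  d^-1 * (h * pb - h * pa) + (h * D - eD) + (h * Q - eQ) = F + G + c * V ->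
  0 <= D -> Xb - Xab <= pb - pa - d / h * F - d / h * c * V ->
  Y <= Q - h^-1 * G -> 2 * Xab <= Xa + Xb ->
  2 * (eD + eQ) <= l * E + l^-1 * W -> 0 < l -> E <= 2 * d * B -> W <= B / h ->
  Xb - Xa + 2 * d * Y <= d / h * (2 * l * d * B + l^-1 * (B / h)).
Proof.
move=> d0 h0 bal D0 HX HY HXab Hyoung l0 HE HW.
have dn := lt0r_neq0 d0; have hn := lt0r_neq0 h0.
have dh0 : 0 <= d / h by rewrite divr_ge0 ?ltW.
have bal' : (pb - pa - d / h * F - d / h * c * V) + d * (Q - h^-1 * G) + d * D =
    d / h * (eD + eQ).
  have <- : d / h * (d^-1 * (h * pb - h * pa) + (h * D - eD) + (h * Q - eQ)
      - (F + G + c * V)) + d / h * (eD + eQ) =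
    (pb - pa - d / h * F - d / h * c * V) + d * (Q - h^-1 * G) + d * D.
    by field; apply/andP; split.
  by rewrite bal subrr mulr0 add0r.
have b1 : l * E + l^-1 * W <= 2 * l * d * B + l^-1 * (B / h).
  apply: lerD; last by apply: ler_wpM2l => //; rewrite invr_ge0 ltW.
  by rewrite (_ : 2 * l * d * B = l * (2 * d * B)); [apply: ler_wpM2l => //; exact: ltW|ring].
have b2 := ler_wpM2l dh0 (le_trans Hyoung b1).
have b3 : 0 <= d * D by rewrite mulr_ge0// ltW.
have b4 : d * Y <= d * (Q - h^-1 * G) by rewrite ler_wpM2l// ltW.
move: bal' b2 b3 b4 HX HXab.
set t1 := d / h * (eD + eQ); set t2 := d / h * (2 * (eD + eQ)).
have -> : t2 = 2 * t1 by rewrite /t2 /t1; ring.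
set P := pb - pa - d / h * F - d / h * c * V; set dQ := d * (Q - h^-1 * G).
set rhs := d / h * (2 * l * d * B + l^-1 * (B / h)); set dD := d * D; set dY := d * Y.
rewrite (_ : 2 * d * Y = 2 * dY); last by rewrite /dY; ring.
move=> bal' b2 b3 b4 HX' HXab'; lra.
Qed.

Lemma young_pair (R : realType) (l eD eQ a1 a2 b1 b1' b2 : R) : 0 < l ->
  2 * eQ <= l * a1 + l^-1 * b1' -> 2 * eD <= l * a2 + l^-1 * b2 -> b1' <= b1 ->
  2 * (eD + eQ) <= l * (a1 + a2) + l^-1 * (b1 + b2).
Proof.
move=> l0 y1 y2 y3; have := ler_wpM2l (ltW (_ : 0 < l^-1)) y3.
rewrite invr_gt0 => /(_ l0) y4; rewrite !mulrDr; lra.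
Qed.

Lemma double_ip_le (R : realType) (p q t : R) :
  0 <= p - 2 * 1 * t + 1 ^+ 2 * q -> 2 * t <= p + q.
Proof. by rewrite expr1n mulr1 mul1r => h; lra. Qed.

Lemma sqr_difference_le (R : realType) (p q t d : R) :
  p <= d -> q <= d -> 0 <= t -> p - t - (t - q) <= 2 * d.
Proof. by move=> *; lra. Qed.

Lemma grid_induction_step (R : realType) (p q e o x d : R) :
  p <= x * e -> 0 <= o -> q - p + o <= d * e -> q <= x * e + d * e.
Proof. by move=> *; lra. Qed.

(** The archimedean property, in the form in which the error O(1/k) is used. *)
Lemma le0_natmul_bounded (R : realType) (x C : R) : (forall k : nat, (0 < k)%N -> x * k%:R <= C) -> x <= 0.
Proof.
move=> xC; rewrite leNgt; apply/negP => x0.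
have C0 : 0 <= C by apply: le_trans (xC 1%N isT); rewrite mulr1 ltW.
have /andP[_ Clt] := truncn_itv (divr_ge0 C0 (ltW x0)).
have := xC _ (ltn0Sn (Num.truncn (C / x))).
by rewrite leNgt mulrC -ltr_pdivrMr// Clt.
Qed.

Section energy_estimate.
Context (R : realType) (N : nat) (s : R) (Omega : set 'rV[R]_N) (T : R).
Hypotheses (mO : measurable Omega) (s_ge0 : 0 <= s) (T_gt0 : 0 < T).
Local Notation leb := (lebesgue_rV R N).
Local Notation leb2 := (@lebesgue_pair R N).
Local Notation mu := (@lebesgue_measure R).
Local Notation delta := (wdiff s Omega).
Local Notation delta_t := (tdiff s Omega).
Variables (r f1 g1 : 'rV[R]_N * R -> R) (v0 : 'rV[R]_N -> R) (Mf Mg M0 : R).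
Hypotheses (Lr : L2_sections leb mu r) (Ldr : L2_sections leb2 mu (delta_t r)).
Hypothesis r_off : forall x t, t \notin `]0, T[ -> r (x, t) = 0.
Hypotheses (Lf1 : L2_sections leb mu f1) (Lg1 : L2_sections leb mu g1) (Lv0 : L2 leb v0).
Hypotheses (f1_le : forall z, f1 z <= Mf) (g1_le : forall z, g1 z <= Mg)
  (v0_le : forall x, v0 x <= M0).
Hypotheses (Mf_ge0 : 0 <= Mf) (Mg_ge0 : 0 <= Mg) (M0_ge0 : 0 <= M0).
Hypothesis identity : forall a b psi, 0 <= a -> a < b -> b <= T -> Hs s Omega psi ->
  (b - a)^-1 * ip leb (avg mu r (cell a b)) (psi \_ Omega)
  + ip leb2 (delta (avg mu r (cutoff T (ramp a b)))) (delta psi)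
  + ip leb (avg mu r (cutoff T (ramp a b))) (psi \_ (~` Omega)) =
  ip leb (avg mu f1 (cutoff T (ramp a b))) (psi \_ Omega)
  + ip leb (avg mu g1 (cutoff T (ramp a b))) (psi \_ (~` Omega))
  + ip leb v0 (psi \_ Omega).

Lemma L2_cutoff_ramp a b : L2 mu (cutoff T (ramp a b)).
Proof.
apply: bounded_cutoff_L2; first exact: measurable_ramp.
by exists 1 => t; rewrite ger0_norm ?ramp_le1 ?ramp_ge0.
Qed.

Lemma cutoff_trapezeE a b h : cutoff T (trapeze a b h) =
  fun t => cutoff T (ramp a b) t - cutoff T (ramp (a - h) (b - h)) t.
Proof.
by apply/funext => t; rewrite /cutoff !patchE; case: ifP => //; rewrite subrr.
Qed.

Lemma avg_off k : (forall t, 0 < t < T -> k t = 0) -> avg mu r k = fun=> 0.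
Proof.
move=> k0; apply/funext => x; rewrite /avg; under eq_Rintegral => t _.
  have -> : r (x, t) * k t = 0.
    have [tT|tT] := boolP (t \in `]0, T[); last by rewrite r_off// mul0r.
    by rewrite k0 ?mulr0//; move: tT; rewrite in_itv.
  over.
by rewrite Rintegral_cst// mul0r.
Qed.

(** For h <= a the initial datum occurs in both identities and cancels.  For
    b <= h the shifted window lies in negative times, where the shifted ramp
    restricted to (0,T) and the averages of r vanish: the identity for [a,b[
    stands alone and keeps the initial datum.  A step straddling h has neither
    property. *)
Lemma difference_identity a b h psi : 0 <= a -> a < b -> b <= T -> 0 < h ->
  h <= a \/ b <= h -> Hs s Omega psi ->
  (b - a)^-1 * (ip leb (avg mu r (cell (b - h) b)) (psi \_ Omega)
     - ip leb (avg mu r (cell (a - h) a)) (psi \_ Omega))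
  + ip leb2 (delta (avg mu r (cutoff T (trapeze a b h)))) (delta psi)
  + ip leb (avg mu r (cutoff T (trapeze a b h))) (psi \_ (~` Omega)) =
  ip leb (avg mu f1 (cutoff T (trapeze a b h))) (psi \_ Omega)
  + ip leb (avg mu g1 (cutoff T (trapeze a b h))) (psi \_ (~` Omega))
  + (b <= h)%R%:R * ip leb v0 (psi \_ Omega).
Proof.
move=> a0 ab bT h0 hab Hpsi.
have [Lpsi Ldpsi] := (HsP mO s_ge0 psi).1 Hpsi.
have LO := L2_restrict mO Lpsi; have LOc := L2_restrict (measurableC mO) Lpsi.
have Lk c d := L2_cutoff_ramp c d.
have Lc (c d : R) := L2_cell c d.
have Lk1 : L2 mu (fun t => cutoff T (ramp a b) t - cutoff T (ramp (a - h) (b - h)) t).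
  exact: L2B.
rewrite -(ip_avgB Lr (Lc _ _) (Lc _ _) LO).
have -> : (fun t => cell (b - h) b t - cell (a - h) a t) =
    (fun t => cell a b t - cell (a - h) (b - h) t).
  by apply/funext => t; rewrite cellB ?ltW.
rewrite !cutoff_trapezeE.
rewrite (ip_avgB Lr (Lc _ _) (Lc _ _) LO) (wdiff_avg s Omega Lr Lk1).
rewrite (ip_avgB Ldr (Lk _ _) (Lk _ _) Ldpsi) (ip_avgB Lr (Lk _ _) (Lk _ _) LOc).
rewrite (ip_avgB Lf1 (Lk _ _) (Lk _ _) LO) (ip_avgB Lg1 (Lk _ _) (Lk _ _) LOc).
rewrite -(wdiff_avg s Omega Lr (Lk a b)) -(wdiff_avg s Omega Lr (Lk (a - h) (b - h))).
have := identity a0 ab bT Hpsi.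
have [ha|ah] := leP h a.
  have := @identity (a - h) (b - h) psi.
  rewrite subr_ge0 ha ltrD2r ab (_ : b - h - (a - h) = b - a); last by ring.
  move=> /(_ isT isT _ Hpsi) E2 E1.
  have bh : b - h <= T by rewrite (le_trans _ bT)// lerBlDr lerDl ltW.
  have {}E2 := E2 bh.
  rewrite leNgt (le_lt_trans ha ab) /= mul0r.
  exact: balance_sub E1 E2.
have {}hab : b <= h by case: hab => // /le_lt_trans /(_ ah); rewrite ltxx.
rewrite hab.
have kz : cutoff T (ramp (a - h) (b - h)) = fun=> 0.
  apply/funext => t; have [tT|tT] := boolP (t \in `]0, T[); last by rewrite cutoffN.
  rewrite cutoffE// ramp_eq0 ?ltrD2r//; move: tT; rewrite in_itv /= => /andP[t0 _].
  by rewrite (le_trans _ (ltW t0))// subr_le0.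
have avg0 d (X : measurableType d) (G : X * R -> R) : avg mu G (fun=> 0) = fun=> 0.
  apply/funext => x; rewrite /avg; under eq_Rintegral do rewrite mulr0.
  by rewrite Rintegral_cst// mul0r.
have ip0 d (X : measurableType d) (m : {measure set X -> \bar R}) (H : X -> R) :
    ip m (fun=> 0) H = 0.
  rewrite /ip; under eq_Rintegral do rewrite mul0r.
  by rewrite Rintegral_cst// mul0r.
have wdiff0 : delta (fun=> 0) = fun=> 0.
  by apply/funext => z; rewrite /wdiff subrr mul0r.
have cz : avg mu r (cell (a - h) (b - h)) = fun=> 0.
  apply: avg_off => t /andP[t0 _]; rewrite cellE; case: (boolP (_ && _)) => // /andP[_].
  by move=> /(lt_trans t0); rewrite subr_gt0 ltNge hab.
have Z1 : ip leb (avg mu r (cell (a - h) (b - h))) (psi \_ Omega) = 0 by rewrite cz ip0.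
have Z2 : ip leb2 (delta (avg mu r (cutoff T (ramp (a - h) (b - h))))) (delta psi) = 0.
  by rewrite kz avg0 wdiff0 ip0.
have Z3 : ip leb (avg mu r (cutoff T (ramp (a - h) (b - h)))) (psi \_ (~` Omega)) = 0.
  by rewrite kz avg0 ip0.
have Z4 : ip leb (avg mu f1 (cutoff T (ramp (a - h) (b - h)))) (psi \_ Omega) = 0.
  by rewrite kz avg0 ip0.
have Z5 : ip leb (avg mu g1 (cutoff T (ramp (a - h) (b - h)))) (psi \_ (~` Omega)) = 0.
  by rewrite kz avg0 ip0.
exact: balance_first Z1 Z2 Z3 Z4 Z5.
Qed.

Lemma avg_trapeze_le (G : 'rV[R]_N * R -> R) M a b h x :
  L2_sections leb mu G -> (forall z, G z <= M) -> 0 <= M -> a < b -> 0 <= h ->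
  avg mu G (cutoff T (trapeze a b h)) x <= M * h.
Proof.
move=> LG GM M0' ab h0; have [_ LGx _] := LG.
have Ik := integrable_cutoff_trapeze T ab h0.
apply: le_trans (ler_wpM2l M0' (Rintegral_cutoff_trapeze T ab h0)).
rewrite -RintegralZl//; apply: le_Rintegral => //.
- apply: L2_mul_integrable => //; rewrite cutoff_trapezeE.
  by apply: L2B; exact: L2_cutoff_ramp.
- rewrite (_ : EFin \o _ = fun t => (M%:E * (cutoff T (trapeze a b h) t)%:E)%E).
    exact: integrableZl.
  by apply/funext => t /=; rewrite EFinM.
- move=> t _; apply: ler_wpM2r => //; rewrite /cutoff patchE; case: ifP => // _.
  exact: trapeze_ge0.
Qed.

Definition average h tau x : R := h^-1 * avg mu r (cell (tau - h) tau) x.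

(** An upper solution for the means: Mf tau absorbs the source f, Mg the exterior
    datum, and M0 min(tau/h, 1) grows at the rate M0 / h as long as the initial
    datum acts as the source rho0 / h. *)
Definition barrier h tau : R := M0 * Num.min (tau / h) 1 + Mf * tau + Mg.

Definition excess h tau x : R := Num.max 0 (average h tau x - barrier h tau).

Definition total_energy : R := energy leb mu r + energy leb2 mu (delta_t r).

Lemma total_energy_ge0 : 0 <= total_energy.
Proof. by rewrite addr_ge0 ?energy_ge0. Qed.

Lemma barrier_ge0 h tau : 0 < h -> 0 <= tau -> Mg <= barrier h tau.
Proof.
move=> h0 t0; rewrite /barrier lerDr addr_ge0 ?mulr_ge0// le_min ler01 andbT.
by rewrite divr_ge0// ltW.
Qed.

Lemma Hs_average h tau : Hs s Omega (average h tau).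
Proof. exact: (HsZ mO s_ge0 h^-1 (Hs_avg mO s_ge0 Lr Ldr (L2_cell (tau - h) tau))). Qed.

Lemma Hs_form_average h tau : 0 < h ->
  Hs_form s Omega (average h tau) (average h tau) <= total_energy / h.
Proof.
move=> h0.
have H : Hs s Omega (avg mu r (cell (tau - h) tau)).
  exact: (Hs_avg mO s_ge0 Lr Ldr (L2_cell (tau - h) tau)).
have := Hs_norm_sqr mO s_ge0 (HsZ mO s_ge0 h^-1 H).
rewrite Hs_normZ// exprMn Hs_norm_sqr// real_normK ?num_real// => <-.
have := Hs_form_avg Lr Ldr (L2_cell (tau - h) tau).
have tauh : tau - h <= tau by rewrite lerBlDr lerDl ltW.
rewrite (ip_cell tauh) (_ : tau - (tau - h) = h) -/total_energy; last by ring.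
move=> le; rewrite (_ : total_energy / h = h^-1 ^+ 2 * (h * total_energy)).
  by apply: ler_wpM2l => //; exact: sqr_ge0.
by field; exact: lt0r_neq0.
Qed.

Lemma measurable_excess h tau : measurable_fun setT (excess h tau).
Proof.
apply: measurable_maxr => //; apply: measurable_funB => //.
by case: (Hs_average h tau).
Qed.

(** Subtracting a nonnegative constant and taking the positive part is a normal
    contraction.  Nonnegativity of the constant is what keeps the excess square
    integrable on the unbounded exterior. *)
Lemma Hs_excess h tau : 0 < h -> 0 <= tau -> Hs s Omega (excess h tau) /\
  Hs_form s Omega (excess h tau) (excess h tau) <= total_energy / h.
Proof.
move=> h0 t0; have K0 := le_trans Mg_ge0 (barrier_ge0 h0 t0).
have [] := @Hs_le _ _ _ _ mO s_ge0 (average h tau) (excess h tau).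
- exact: measurable_excess.
- move=> x; rewrite /excess; case: (leP 0 (average h tau x - barrier h tau)) => H.
    by rewrite !ger0_norm//; lra.
  by rewrite normr0.
- move=> x y; rewrite /excess; set K := barrier h tau.
  rewrite (_ : average h tau x - average h tau y =
    (average h tau x - K) - (average h tau y - K)); last by ring.
  exact: pos_part_contract.
- exact: Hs_average.
by move=> He le; split => //; apply: le_trans le _; exact: Hs_form_average.
Qed.

(** The excess is a nondecreasing function of the average, so the two differences
    have the same sign at each pair of points. *)
Lemma energy_average_excess h tau :
  0 <= ip leb2 (delta (average h tau)) (delta (excess h tau)).
Proof.
apply: ip_ge0 => z; rewrite wdiffM//; apply: mulr_ge0.
  by rewrite divr_ge0 ?CNs_ge0.
rewrite mulr_ge0// ?indicE// mulr_ge0 ?invr_ge0 ?powR_ge0//.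
set x := average h tau z.1; set y := average h tau z.2.
rewrite /excess -/x -/y (_ : x - y = (x - barrier h tau) - (y - barrier h tau)); last by ring.
exact: pos_part_monotone.
Qed.

Definition inside h tau : R := ip leb (excess h tau \_ Omega) (excess h tau \_ Omega).
Definition outside h tau : R :=
  ip leb (excess h tau \_ (~` Omega)) (excess h tau \_ (~` Omega)).

(** What remains inside Omega of the difference identity: the increment of the
    mean minus the contributions of f and of the initial datum. *)
Let drift a b h x : R :=
  average h b x - average h a x
  - (b - a) / h * avg mu f1 (cutoff T (trapeze a b h)) x
  - (b - a) / h * (b <= h)%R%:R * v0 x.

Lemma barrier_incr a b h : 0 <= a -> a < b -> 0 < h -> h <= a \/ b <= h ->
  barrier h b - barrier h a = M0 * ((b - a) / h * (b <= h)%R%:R) + Mf * (b - a).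
Proof.
move=> a0 ab h0 hab; rewrite /barrier.
have [bh|hb] := leP b h.
  rewrite !min_l ?ler_pdivrMr ?mul1r//; last by rewrite (le_trans (ltW ab)).
  by rewrite mulr1; field; exact: lt0r_neq0.
have ha : h <= a by case: hab => // /(lt_le_trans hb); rewrite ltxx.
rewrite !min_r ?ler_pdivlMr ?mul1r//; last exact: ltW.
by rewrite mulr0; ring.
Qed.

(** Where the excess at b is positive, it is average minus barrier at b, while at
    a it is at least average minus barrier; so its increment is at most that of
    the average minus that of the barrier, and the latter dominates the data. *)
Lemma drift_ge a b h x : 0 <= a -> a < b -> 0 < h -> h <= a \/ b <= h ->
  (excess h b x - excess h a x) * excess h b x <= drift a b h x * excess h b x.
Proof.
move=> a0 ab h0 hab; have dh0 : 0 <= (b - a) / h by apply: divr_ge0; [rewrite subr_ge0|]; exact: ltW.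
have Fle : avg mu f1 (cutoff T (trapeze a b h)) x <= Mf * h.
  by apply: avg_trapeze_le => //; exact: ltW.
have Vle := v0_le x; have incr := barrier_incr a0 ab h0 hab.
have ea : average h a x - barrier h a <= excess h a x by rewrite /excess le_max lexx orbT.
rewrite /drift; set F := avg mu f1 _ x in Fle *; set c := (b <= h)%R%:R in incr *.
have c0 : 0 <= c :> R by rewrite /c ler0n.
have F1 : (b - a) / h * F <= Mf * (b - a).
  rewrite (_ : Mf * (b - a) = (b - a) / h * (Mf * h)); first exact: ler_wpM2l.
  by field; exact: lt0r_neq0.
have V1 : (b - a) / h * c * v0 x <= M0 * ((b - a) / h * c).
  by rewrite [leRHS]mulrC; apply: ler_wpM2l => //; exact: mulr_ge0.
rewrite {1 3 4}/excess; set u := average h b x.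
have [ub|ub] := leP 0 (u - barrier h b); last by rewrite !mulr0.
apply: ler_wpM2r => //.
move: ea incr F1 V1; set p := (b - a) / h * F; set q := (b - a) / h * c.
set K := barrier h b; set K' := barrier h a; set e := excess h a x; set ua := average h a x.
move: (q * v0 x) => qv ea incr F1 V1; lra.
Qed.

(** The mean of g is at most Mg, which is below the barrier. *)
Lemma outside_ge h tau x : 0 < h -> 0 <= tau -> forall G, G <= Mg * h ->
  excess h tau x * excess h tau x <= (average h tau x - h^-1 * G) * excess h tau x.
Proof.
move=> h0 t0 G HG; have bM : Mg <= barrier h tau by exact: barrier_ge0.
rewrite /excess; set u := average h tau x; set K := barrier h tau.
have [ub|ub] := leP 0 (u - K); last by rewrite !mulr0.
apply: ler_wpM2r => //; rewrite lerD2l lerN2.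
apply: le_trans bM; rewrite mulrC ler_pdivrMr//.
Qed.

(** The difference identity tested with the excess at b. *)
Lemma step_inequality a b h l : 0 <= a -> a < b -> b <= T -> 0 < h ->
  h <= a \/ b <= h -> 0 < l ->
  inside h b - inside h a + 2 * (b - a) * outside h b <=
    (b - a) / h * (2 * l * (b - a) * total_energy + l^-1 * (total_energy / h)).
Proof.
move=> a0 ab bT h0 hab l0; have b0 : 0 <= b by exact: le_trans a0 (ltW ab).
have d0 : 0 < b - a by rewrite subr_gt0.
have hn := lt0r_neq0 h0.
have [Hw Ww] : Hs s Omega (excess h b) /\
    Hs_form s Omega (excess h b) (excess h b) <= total_energy / h by exact: Hs_excess.
have [Lw Ldw] := (HsP mO s_ge0 (excess h b)).1 Hw.
have [Hwa _] : Hs s Omega (excess h a) /\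
    Hs_form s Omega (excess h a) (excess h a) <= total_energy / h by exact: Hs_excess.
have [Lwa _] := (HsP mO s_ge0 (excess h a)).1 Hwa.
have mOc := measurableC mO.
have LwO := L2_restrict mO Lw; have LwaO := L2_restrict mO Lwa.
have LwOc := L2_restrict mOc Lw.
have Hu tau : Hs s Omega (average h tau) by exact: Hs_average.
have Lu tau : L2 leb (average h tau) by case: ((HsP mO s_ge0 (average h tau)).1 (Hu tau)).
have Ldu tau : L2 leb2 (delta (average h tau)).
  by case: ((HsP mO s_ge0 (average h tau)).1 (Hu tau)).
pose ta := tooth a b; pose tb := tooth (a - h) (b - h).
have abh : a - h < b - h by rewrite ltrD2r.
have Lta : L2 mu ta := L2_tooth ab; have Ltb : L2 mu tb := L2_tooth abh.
have Le : L2 mu (fun t => ta t - tb t) := L2B Lta Ltb.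
(* The average of r over the trapeze is h times its mean at b, minus the
   contribution E of the two teeth, which is the only error of the scheme. *)
pose E := avg mu r (fun t => ta t - tb t).
have HE : Hs s Omega E := Hs_avg mO s_ge0 Lr Ldr Le.
have [LE LdE] := (HsP mO s_ge0 E).1 HE.
have Leta : L2 mu (cutoff T (trapeze a b h)).
  by rewrite cutoff_trapezeE; apply: L2B; exact: L2_cutoff_ramp.
have avgu tau : avg mu r (cell (tau - h) tau) = fun x => h * average h tau x.
  by apply/funext => x; rewrite /average mulrA divff// mul1r.
have avgE : avg mu r (cutoff T (trapeze a b h)) = fun x => h * average h b x - E x.
  apply/funext => x.
  transitivity (avg mu r (fun t => cell (b - h) b t - (ta t - tb t)) x).
    congr (_ x); apply: eq_avg => y t.
    have [tT|tT] := boolP (t \in `]0, T[); last by rewrite r_off// !mul0r.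
    by rewrite cutoffE// trapezeE// ltW.
  by rewrite (avgB x Lr (L2_cell (b - h) b) Le) avgu.
have := difference_identity a0 ab bT h0 hab Hw.
have EpO tau : ip leb (avg mu r (cell (tau - h) tau)) (excess h b \_ Omega) =
    h * ip leb (average h tau) (excess h b \_ Omega).
  by rewrite avgu; exact: ipZl (Lu tau) LwO.
have EQ : ip leb (avg mu r (cutoff T (trapeze a b h))) (excess h b \_ (~` Omega)) =
    h * ip leb (average h b) (excess h b \_ (~` Omega)) - ip leb E (excess h b \_ (~` Omega)).
  by rewrite avgE (ipBl (L2Z h (Lu b)) LE LwOc) (ipZl h (Lu b) LwOc).
have ED : ip leb2 (delta (avg mu r (cutoff T (trapeze a b h)))) (delta (excess h b)) =
    h * ip leb2 (delta (average h b)) (delta (excess h b)) - ip leb2 (delta E) (delta (excess h b)).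
  rewrite avgE (_ : delta _ = fun z => h * delta (average h b) z - delta E z).
    by rewrite (ipBl (L2Z h (Ldu b)) LdE Ldw) (ipZl h (Ldu b) Ldw).
  by apply/funext => z; rewrite /wdiff; ring.
rewrite (EpO a) (EpO b) EQ ED => bal.
have LF : L2 leb (avg mu f1 (cutoff T (trapeze a b h))) := L2_avg Lf1 Leta.
have LG : L2 leb (avg mu g1 (cutoff T (trapeze a b h))) := L2_avg Lg1 Leta.
pose Xab := ip leb (excess h a \_ Omega) (excess h b \_ Omega).
apply: (discrete_energy_step (Xab := Xab) (E := Hs_form s Omega E E)
  (W := Hs_form s Omega (excess h b) (excess h b)) d0 h0 bal) => //.
- exact: energy_average_excess.
- set F := avg mu f1 _ in LF *.
  pose u1 x := average h b x - average h a x.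
  pose u2 x := u1 x - (b - a) / h * F x.
  have L1 : L2 leb u1 := L2B (Lu b) (Lu a).
  have L2' : L2 leb u2 := L2B L1 (L2Z ((b - a) / h) LF).
  have L3 : L2 leb (drift a b h) := L2B L2' (L2Z ((b - a) / h * (b <= h)%R%:R) Lv0).
  have Lww : L2 leb (fun x => (excess h b \_ Omega) x - (excess h a \_ Omega) x) := L2B LwO LwaO.
  have -> : inside h b - Xab =
      ip leb (fun x => (excess h b \_ Omega) x - (excess h a \_ Omega) x) (excess h b \_ Omega).
    by rewrite (ipBl LwO LwaO LwO).
  have <- : ip leb (drift a b h) (excess h b \_ Omega) =
      ip leb (average h b) (excess h b \_ Omega) - ip leb (average h a) (excess h b \_ Omega)
      - (b - a) / h * ip leb F (excess h b \_ Omega)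
      - (b - a) / h * (b <= h)%R%:R * ip leb v0 (excess h b \_ Omega).
    rewrite (ipBl L2' (L2Z ((b - a) / h * (b <= h)%R%:R) Lv0) LwO).
    rewrite (ipBl L1 (L2Z ((b - a) / h) LF) LwO) (ipBl (Lu b) (Lu a) LwO).
    by rewrite (ipZl _ LF LwO) (ipZl _ Lv0 LwO).
  apply: (le_ip Lww LwO L3 LwO) => x; rewrite !patchE.
  by case: ifP => _; [exact: drift_ge|rewrite !mulr0].
- rewrite -(ipZl h^-1 LG LwOc) -(ipBl (Lu b) (L2Z h^-1 LG) LwOc).
  apply: (le_ip LwOc LwOc (L2B (Lu b) (L2Z h^-1 LG)) LwOc) => x; rewrite !patchE.
  case: ifP => _; last by rewrite !mulr0.
  apply: outside_ge => //.
  by apply: avg_trapeze_le => //; exact: ltW.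
- exact: double_ip_le (ip_quadratic 1 LwaO LwO).
- have y3 : ip leb (excess h b \_ (~` Omega)) (excess h b \_ (~` Omega)) <=
      ip leb (excess h b) (excess h b).
    apply: (le_ip LwOc LwOc Lw Lw) => x; rewrite patchE; case: ifP => // _.
    by rewrite mulr0 -expr2 sqr_ge0.
  exact: young_pair l0 (ip_young l0 LE LwOc) (ip_young l0 LdE Ldw) y3.
- apply: le_trans (Hs_form_avg Lr Ldr Le) _; apply: ler_wpM2r; first exact: total_energy_ge0.
  (* The teeth are nonnegative, so the cross term only helps. *)
  rewrite (ipBl Lta Ltb Le) (ipC mu ta) (ipC mu tb) (ipBl Lta Ltb Lta) (ipBl Lta Ltb Ltb).
  have i1 := ip_tooth_le ab; have i2 := ip_tooth_le abh.
  have i3 : 0 <= ip mu ta tb by apply: ip_ge0 => t; rewrite mulr_ge0 ?tooth_ge0.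
  rewrite (ipC mu tb ta); rewrite (_ : b - h - (a - h) = b - a) in i2; last by ring.
  exact: sqr_difference_le i1 i2 i3.
Qed.

Lemma inside0 h : 0 < h -> inside h 0 = 0.
Proof.
move=> h0; rewrite /inside (_ : excess h 0 = fun=> 0).
  have -> : (fun=> 0) \_ Omega = (fun=> 0) :> ('rV[R]_N -> R).
    by apply/funext => x; rewrite patchE; case: ifP.
  rewrite /ip; under eq_Rintegral do rewrite mul0r.
  by rewrite Rintegral_cst// mul0r.
apply/funext => x; rewrite /excess max_l//.
have -> : average h 0 x = 0.
  rewrite /average (_ : avg mu r _ = fun=> 0) ?mulr0//.
  apply: avg_off => t /andP[t0 _].
  by rewrite cellE (ltNge t) (ltW t0) andbF.
rewrite sub0r oppr_le0; apply: le_trans Mg_ge0 _.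
by apply: barrier_ge0.
Qed.

(** The error of one step of length d, per unit of time. *)
Definition step_error d h l : R :=
  h^-1 * (2 * l * d * total_energy + l^-1 * (total_energy / h)).

(** When the window length is a multiple of the mesh, no step of the grid
    straddles it. *)
Lemma grid_side n m j : (0 < n)%N ->
  m%:R * (T / n%:R) <= j%:R * (T / n%:R) \/
  j.+1%:R * (T / n%:R) <= m%:R * (T / n%:R).
Proof.
move=> n0; have d0 : 0 < T / n%:R by rewrite divr_gt0 ?ltr0n.
by rewrite !ler_pM2r// !ler_nat; case: (leqP m j) => ?; [left|right].
Qed.

Lemma inside_grid n m j l : (0 < n)%N -> (0 < m)%N -> (j <= n)%N -> 0 < l ->
  inside (m%:R * (T / n%:R)) (j%:R * (T / n%:R)) <=
    j%:R * (T / n%:R) * step_error (T / n%:R) (m%:R * (T / n%:R)) l.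
Proof.
move=> n0 m0 + l0; set d := T / n%:R; set h := m%:R * d.
have d0 : 0 < d by rewrite divr_gt0 ?ltr0n.
have h0 : 0 < h by rewrite mulr_gt0 ?ltr0n.
elim: j => [_|j IH jn]; first by rewrite !mul0r inside0.
have {}IH := IH (ltnW jn).
have a0 : 0 <= j%:R * d by rewrite mulr_ge0 ?ler0n ?ltW.
have ab : j%:R * d < j.+1%:R * d by rewrite ltr_pM2r// ltr_nat.
have bT : j.+1%:R * d <= T.
  by rewrite /d mulrCA ger_pMr// ler_pdivrMr ?ltr0n// mul1r ler_nat.
have := step_inequality a0 ab bT h0 (grid_side m j n0) l0.
set a := j%:R * d in IH a0 ab *; set b := j.+1%:R * d in ab bT *.
have bE : b = a + d by rewrite /b -natr1 mulrDl mul1r.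
have dE : b - a = d by rewrite bE addrC addKr.
have o0 : 0 <= 2 * d * outside h b by rewrite mulr_ge0 ?ipff_ge0// mulr_ge0// ltW.
rewrite dE -(mulrA d) -/(step_error d h l) [X in _ -> _ <= X * _]bE (mulrDl a d) => S.
exact: grid_induction_step IH o0 S.
Qed.

(** Dividing the mesh by k^2 while taking k as Young parameter balances the two
    parts of the error, both of which become O(1/k). *)
Lemma step_error_refine n h k : (0 < n)%N -> 0 < h -> (0 < k)%N ->
  step_error (T / (n * k ^ 2)%:R) h k%:R =
  h^-1 * (2 * (T / n%:R) * total_energy + total_energy / h) / k%:R.
Proof.
move=> n0 h0 k0; rewrite /step_error natrM natrX.
move: total_energy => B; have hn := lt0r_neq0 h0.
have nn : n%:R != 0 :> R by rewrite pnatr_eq0 -lt0n.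
have kn : k%:R != 0 :> R by rewrite pnatr_eq0 -lt0n.
by field; rewrite hn nn kn.
Qed.

Lemma grid_refine n j k : (0 < n)%N -> (0 < k)%N ->
  (j * k ^ 2)%:R * (T / (n * k ^ 2)%:R) = j%:R * (T / n%:R).
Proof.
move=> n0 k0; rewrite !natrM.
have nn : n%:R != 0 :> R by rewrite pnatr_eq0 -lt0n.
have kn : k%:R != 0 :> R by rewrite pnatr_eq0 -lt0n.
by field; rewrite nn kn.
Qed.

(** The excess depends on the window length and on the time only, so the estimate
    of its norm on all refined grids is an estimate of one and the same number. *)
Lemma inside_eq0 n m j : (0 < n)%N -> (0 < m)%N -> (j <= n)%N ->
  inside (m%:R * (T / n%:R)) (j%:R * (T / n%:R)) = 0.
Proof.
move=> n0 m0 jn; apply/eqP; rewrite eq_le ipff_ge0 andbT.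
set h := m%:R * (T / n%:R); set tau := j%:R * (T / n%:R).
have h0 : 0 < h by rewrite mulr_gt0 ?ltr0n// divr_gt0 ?ltr0n.
apply: (le0_natmul_bounded (C := tau * (h^-1 * (2 * (T / n%:R) * total_energy + total_energy / h)))).
move=> k k0; have kk : (0 < k ^ 2)%N by rewrite expn_gt0 k0.
have nk : (0 < n * k ^ 2)%N by rewrite muln_gt0 n0.
have mk : (0 < m * k ^ 2)%N by rewrite muln_gt0 m0.
have jk : (j * k ^ 2 <= n * k ^ 2)%N by rewrite leq_mul2r jn orbT.
have kR : 0 < k%:R :> R by rewrite ltr0n.
have := inside_grid nk mk jk kR.
rewrite !grid_refine// -/h -/tau step_error_refine// (mulrA tau).
by rewrite ler_pdivlMr.
Qed.

(** The last step of the refined grid suffices: the excess inside Omega vanishes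
    at both of its ends. *)
Lemma outside_eq0 n m j : (0 < n)%N -> (0 < m)%N -> (0 < j <= n)%N ->
  outside (m%:R * (T / n%:R)) (j%:R * (T / n%:R)) = 0.
Proof.
move=> n0 m0 /andP[j0 jn]; apply/eqP; rewrite eq_le ipff_ge0 andbT.
have X0 := inside_eq0 n0 m0 jn.
set h := m%:R * (T / n%:R) in X0 *; set tau := j%:R * (T / n%:R) in X0 *.
have h0 : 0 < h by rewrite mulr_gt0 ?ltr0n// divr_gt0 ?ltr0n.
apply: (le0_natmul_bounded (C := h^-1 * (2 * (T / n%:R) * total_energy + total_energy / h))).
move=> k k0; have kk : (0 < k ^ 2)%N by rewrite expn_gt0 k0.
have nk : (0 < n * k ^ 2)%N by rewrite muln_gt0 n0.
have mk : (0 < m * k ^ 2)%N by rewrite muln_gt0 m0.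
have jk : (j * k ^ 2 <= n * k ^ 2)%N by rewrite leq_mul2r jn orbT.
have jk0 : (0 < j * k ^ 2)%N by rewrite muln_gt0 j0.
have jk' : ((j * k ^ 2).-1 <= n * k ^ 2)%N by rewrite (leq_trans (leq_pred _)).
have kR : 0 < k%:R :> R by rewrite ltr0n.
have Xa := inside_eq0 nk mk jk'.
have side := grid_side (m * k ^ 2) (j * k ^ 2).-1 nk.
rewrite (prednK jk0) !grid_refine// -/h -/tau in side.
rewrite grid_refine// -/h in Xa.
have Etau : (j * k ^ 2)%:R * (T / (n * k ^ 2)%:R) = tau := grid_refine j n0 k0.
set d := T / (n * k ^ 2)%:R in Xa side Etau *.
have d0 : 0 < d by rewrite divr_gt0 ?ltr0n.
set a := (j * k ^ 2).-1%:R * d in Xa side *.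
have a0 : 0 <= a by rewrite mulr_ge0 ?ler0n ?ltW.
have dE : tau - a = d by rewrite -Etau -(prednK jk0) -natr1 mulrDl mul1r addrC addKr.
have ab : a < tau by rewrite -subr_gt0 dE.
have bT : tau <= T.
  by rewrite /tau mulrCA ger_pMr// ler_pdivrMr ?ltr0n// mul1r ler_nat.
have := step_inequality a0 ab bT h0 side kR.
rewrite Xa X0 subrr add0r dE -mulrA -mulrA (mulrCA 2) ler_pM2l// -/(step_error d h k%:R).
rewrite /d step_error_refine// => le; rewrite -ler_pdivlMr//; apply: le_trans le.
by rewrite ler_peMl ?ipff_ge0// ler1n.
Qed.

End energy_estimate.

(** * From means over grid cells to pointwise bounds *)
Section cells.
Context (R : realType) (T : R).
Hypothesis T_gt0 : 0 < T.
Local Notation mu := (@lebesgue_measure R).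

Let d (n : nat) : R := T / n.+1%:R.
Let d_gt0 n : 0 < d n. Proof. by rewrite divr_gt0 ?ltr0n. Qed.

(** The cell of the grid of mesh T/(n+1) that contains t. *)
Definition dcell (t : R) (n : nat) : set R :=
  `[(Num.floor (t / d n))%:~R * d n, (Num.floor (t / d n) + 1)%:~R * d n[%classic.

Let dcellE t n : (Num.floor (t / d n))%:~R * d n <= t < (Num.floor (t / d n) + 1)%:~R * d n.
Proof.
have /andP[h1 h2] := floor_itv (t / d n).
by rewrite -ler_pdivlMr// h1 -ltr_pdivrMr.
Qed.

Let dcell_length t n :
  (Num.floor (t / d n) + 1)%:~R * d n - (Num.floor (t / d n))%:~R * d n = d n.
Proof. by rewrite intrD mulrDl mul1r addrC addKr. Qed.

Let mu_dcell t n : mu (dcell t n) = (d n)%:E.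
Proof.
rewrite /dcell lebesgue_cell; first by rewrite dcell_length.
by have /andP[h1 h2] := dcellE t n; apply: le_trans h1 (ltW h2).
Qed.

(** A cell is not centred at t, but it is contained in the ball of radius d n
    around t and fills half of it: Lebesgue's theorem applies to such families. *)
Lemma nicely_shrinking_dcell t : nicely_shrinking t (dcell t).
Proof.
split; first by move=> n; exact: measurable_itv.
exists (2, fun n => PosNum (d_gt0 n)); split => //=.
- rewrite -(mulr0 T); apply: cvgMr.
  apply/cvgrPdist_lt => e e0; near=> k; rewrite sub0r normrN ger0_norm ?invr_ge0//.
  by near: k; exact: (near_infty_natSinv_lt (PosNum e0)).
- move=> n y; rewrite /dcell /= in_itv /= => /andP[y1 y2].
  have /andP[t1 t2] := dcellE t n; have := dcell_length t n.
  rewrite /ball /= ltr_distl.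
  set p := _ * d n in y1 t1 *; set q := (_ + 1)%:~R * d n in y2 t2 *.
  by move=> len; apply/andP; split; lra.
- move=> n; rewrite lebesgue_measure_ball; last exact: ltW.
  by rewrite mu_dcell -EFinM lee_fin mulr_natl lexx.
Unshelve. all: end_near. Qed.

Lemma le_of_cell_averages (f : R -> R) (M : R) : mu.-integrable setT (EFin \o f) ->
  (forall n i, (i <= n)%N ->
    \int[mu]_t (f t * cell (i%:R * (T / n.+1%:R)) (i.+1%:R * (T / n.+1%:R)) t)
      <= M * (T / n.+1%:R)) ->
  {ae mu, forall t : R, 0 < t < T -> f t <= M}.
Proof.
move=> If fM; have mf : measurable_fun setT f by apply/measurable_EFinP; case/integrableP: If.
have locf : locally_integrable setT f by apply: open_integrable_locally => //; exact: openT.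
apply: aeS (lebesgue_differentiation locf) => t ft /andP[t0 tT].
have cv := nice_lebesgue_differentiation nicely_shrinking_dcell locf ft.
rewrite -lee_fin -(cvg_lim _ cv)//; apply: lime_le; first by apply/cvg_ex; exists (f t)%:E.
apply: nearW => n; rewrite mu_dcell.
have [i iE] : exists i : nat, Num.floor (t / d n) = i%:Z.
  exists `|Num.floor (t / d n)|%N; rewrite gez0_abs// floor_ge0.
  by rewrite divr_ge0// ltW.
have i_n : (i <= n)%N.
  have /andP[h1 _] := dcellE t n; have := le_lt_trans h1 tT.
  rewrite iE -pmulrn /d mulrA ltr_pdivrMr ?ltr0n// mulrC ltr_pM2l// ltr_nat ltnS.
  exact.
rewrite inver (negbTE (lt0r_neq0 (d_gt0 n))).
have -> : (\int[mu]_(y in dcell t n) (f y)%:E)%E =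
    (\int[mu]_t (f t * cell (i%:R * (T / n.+1%:R)) (i.+1%:R * (T / n.+1%:R)) t))%:E.
  rewrite /Rintegral fineK.
    rewrite [LHS]integral_mkcond; apply: eq_integral => y _.
    rewrite patchE /dcell iE mem_setE cellE in_itv /= intrD mulr1z -!pmulrn natr1.
    by case: (_ && _); rewrite ?mulr1 ?mulr0.
  apply: integrable_fin_num => //; apply: le_integrable (If) => //.
    apply/measurable_EFinP; apply: measurable_funM; last exact: measurable_indic.
    exact: mf.
  move=> y _ /=; rewrite lee_fin normrM ler_piMr// cellE.
  by case: (_ && _); rewrite ?normr1 ?normr0.
rewrite -EFinM lee_fin mulrC ler_pdivrMr//; exact: fM.
Qed.

End cells.

Section space_time_null_sets.
Context (R : realType) (N : nat) (T : R).
Local Notation leb := (lebesgue_rV R N).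
Local Notation mu := (@lebesgue_measure R).

(** The set where the bound fails is measurable and almost all of its sections
    are null, so it is null by the definition of the product measure. *)
Lemma ae_space_time (r : 'rV[R]_N * R -> R) (M : R) : measurable_fun setT r ->
  {ae leb, forall x, {ae mu, forall t : R, 0 < t < T -> r (x, t) <= M}} ->
  {ae space_time R N, forall z : 'rV[R]_N * R, 0 < z.2 < T -> r z <= M}.
Proof.
move=> mr rM.
pose A := [set z : 'rV[R]_N * R | 0 < z.2 < T /\ M < r z].
have mA : measurable A.
  rewrite (_ : A = ([set: 'rV[R]_N] `*` `]0, T[%classic) `&` (r @^-1` `]M, +oo[%classic)).
    apply: measurableI; first by apply: measurableX => //; exact: measurable_itv.
    by rewrite -[X in measurable X]setTI; apply: mr => //; exact: measurable_itv.
  apply/seteqP; split => -[x t]; rewrite /A /= !in_itv /= andbT.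
    by move=> [? ?].
  by move=> [[]].
exists A; split => //.
- rewrite /space_time /=.
  have mAx := measurable_fun_xsection mu mA.
  transitivity (\int[leb]_x (cst 0%E x))%E; last exact: integral0.
  apply: ae_eq_integral => //.
  apply: aeS rM => x [B [mB B0 AB]] _ /=.
  apply/eqP; rewrite eq_le measure_ge0 andbT -B0.
  apply: le_measure; rewrite ?inE//; first exact: measurable_xsection.
  move=> t; rewrite /xsection /= inE => -[/= t0T rt]; apply: AB => /=.
  by move=> /(_ t0T); rewrite leNgt rt.
- move=> z /=; move=> /not_implyP[zT /negP]; rewrite -ltNge => zM.
  by split.
Qed.

Lemma ae_neq_ends : {ae space_time R N, forall z : 'rV[R]_N * R, z.2 != 0 /\ z.2 != T}.
Proof.
have E A C : measurable A -> measurable C -> (space_time R N (A `*` C) = leb A * mu C)%E.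
  by move=> mA mC; exact: product_measure1E.
have null (c : R) : {ae space_time R N, forall z : 'rV[R]_N * R, z.2 != c}.
  exists (setT `*` [set c]); split.
  - exact: measurableX.
  - by apply: (etrans (E _ _ measurableT (measurable_set1 c))); rewrite lebesgue_measure_set1 mule0.
  - by move=> z /= /negP; rewrite negbK => /eqP.
exact: aeI (null 0) (null T).
Qed.

End space_time_null_sets.

Theorem corollary4p8 (R : realType) (N : nat) (Omega : set 'rV[R]_N) (s T : R)
    (f g : 'rV[R]_N * R -> R) (rho0 : 'rV[R]_N -> R) (rho : 'rV[R]_N * R -> R)
    (N_ge1 : (1 <= N)%N) (Omega_lip : lipschitz_domain Omega)
    (s_gt0 : 0 < s) (s_lt1 : s < 1) (T_gt0 : 0 < T)
    (f_Linf : f \_ (Qcyl Omega T) \in Lfun (space_time R N) +oo%E)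
    (g_L2 : g \_ (Sigma Omega T) \in Lfun (space_time R N) 2%:E)
    (g_Linf : g \_ (Sigma Omega T) \in Lfun (space_time R N) +oo%E)
    (rho0_Linf : rho0 \_ Omega \in Lfun (lebesgue_rV R N) +oo%E)
    (rho_sol : weak_solution s Omega T f g rho0 rho) :
  {ae space_time R N, forall z : 'rV[R]_N * R, z.2 \in `[0, T] ->
    ((rho z)%:E <= (expR T)%:E *
      ('N[lebesgue_rV R N]_+oo%E [EFin \o (rho0 \_ Omega)]
       + 'N[space_time R N]_+oo%E [EFin \o (f \_ (Qcyl Omega T))]
       + 'N[space_time R N]_+oo%E [EFin \o (g \_ (Sigma Omega T))]))%E}.
Proof.
have [_ oO _ bO _] := Omega_lip.
have mO := open_measurable_rV oO; have s_ge0 := ltW s_gt0.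
have Ofin := bounded_finite_measure mO bO.
have [Mf [Mf0 -> mf fMf]] := Lfun_infty_bound f_Linf.
have [Mg [Mg0 -> mg gMg]] := Lfun_infty_bound g_Linf.
have [M0 [M00 -> m0 rMo]] := Lfun_infty_bound rho0_Linf.
have [r [Lr Ldr r_off rE]] := W0T_representative mO s_ge0 rho_sol.1.
pose f1 := clamp Mf (f \_ (Qcyl Omega T)).
pose g1 := clamp Mg (g \_ (Sigma Omega T)).
pose v0 := clamp M0 (rho0 \_ Omega).
have clamp0 d (X : measurableType d) (h : X -> R) M x : 0 <= M -> h x = 0 -> clamp M h x = 0.
  by move=> M_0 hx; have := clamp_le h x M_0; rewrite hx normr0 normr_le0 => /eqP.
have offQ x t : t \notin `]0, T[ -> (f \_ (Qcyl Omega T)) (x, t) = 0.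
  by move=> tT; rewrite patchE memNset// => -[_ /=]; exact/negP.
have offS x t : t \notin `]0, T[ -> (g \_ (Sigma Omega T)) (x, t) = 0.
  by move=> tT; rewrite patchE memNset// => -[_ /=]; exact/negP.
have Lf1 : L2_sections (lebesgue_rV R N) (@lebesgue_measure R) f1.
  apply: (L2_sections_bounded mO (M := Mf) (T := T)) => //.
  - exact: measurable_clamp.
  - by move=> z; exact: clamp_bound.
  - by move=> x t tT; apply: clamp0 => //; exact: offQ.
  - by move=> x t xO; apply: clamp0 => //; rewrite patchE memNset// => -[].
have Lg1 : L2_sections (lebesgue_rV R N) (@lebesgue_measure R) g1.
  apply: (L2_sections_dominated (M := Mg) (T := T) (g := g \_ (Sigma Omega T))) => //.
  - exact: measurable_clamp.
  - by move=> z; exact: clamp_bound.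
  - by move=> x t tT; apply: clamp0 => //; exact: offS.
  - exact: Lfun_L2.
  - by move=> z; exact: clamp_le.
have Lv0 : L2 (lebesgue_rV R N) v0.
  split; first exact: measurable_clamp.
  apply: (@le_lt_trans _ _ (\int[lebesgue_rV R N]_(x in Omega) (M0 ^+ 2)%:E)%E); last first.
    by rewrite integral_cst//; apply: lte_mul_pinfty => //; rewrite lee_fin sqr_ge0.
  rewrite [leRHS]integral_mkcond; apply: ge0_le_integral => //.
  - by move=> x _; rewrite lee_fin sqr_ge0.
  - by apply/measurable_EFinP; apply: measurable_funX; exact: measurable_clamp.
  - by apply/(measurable_restrictT _ _).1 => //; exact: measurable_cst.
  - move=> x _; rewrite patchE; case: ifPn => xO; last first.
      by rewrite /v0 clamp0 ?expr0n// patchE (negbTE xO).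
    by rewrite lee_fin -[leLHS]real_normK ?num_real// lerXn2r ?nnegrE// clamp_bound.
have f1E : {ae space_time R N, forall z, (f \_ (Qcyl Omega T)) z = f1 z}.
  by apply: aeS fMf => z fz; rewrite /f1 clamp_id.
have g1E : {ae space_time R N, forall z, (g \_ (Sigma Omega T)) z = g1 z}.
  by apply: aeS gMg => z gz; rewrite /g1 clamp_id.
have v0E : {ae lebesgue_rV R N, forall x, (rho0 \_ Omega) x = v0 x}.
  by apply: aeS rMo => x vx; rewrite /v0 clamp_id.
have id a b psi : 0 <= a -> a < b -> b <= T -> Hs s Omega psi ->
  (b - a)^-1 * ip (lebesgue_rV R N) (avg lebesgue_measure r (cell a b)) (psi \_ Omega)
  + ip (@lebesgue_pair R N) (wdiff s Omega (avg lebesgue_measure r (cutoff T (ramp a b))))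
      (wdiff s Omega psi)
  + ip (lebesgue_rV R N) (avg lebesgue_measure r (cutoff T (ramp a b))) (psi \_ (~` Omega)) =
  ip (lebesgue_rV R N) (avg lebesgue_measure f1 (cutoff T (ramp a b))) (psi \_ Omega)
  + ip (lebesgue_rV R N) (avg lebesgue_measure g1 (cutoff T (ramp a b))) (psi \_ (~` Omega))
  + ip (lebesgue_rV R N) v0 (psi \_ Omega).
  by move=> a0 ab bT Hpsi; exact: (averaged_identity mO s_ge0 rho_sol Lr Ldr r_off rE Lf1 Lg1 Lv0 mf mg m0 f1E g1E v0E a0 ab bT Hpsi).
have f1le z : f1 z <= Mf by apply: le_trans (ler_norm _) (clamp_bound _ _ Mf0).
have g1le z : g1 z <= Mg by apply: le_trans (ler_norm _) (clamp_bound _ _ Mg0).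
have v0le x : v0 x <= M0 by apply: le_trans (ler_norm _) (clamp_bound _ _ M00).
pose K := M0 + Mf * T + Mg.
(* The window is one grid cell, so that the mean at the time i.+1 is the mean over
   the i-th cell; the null sets for the countably many cells are collected. *)
have cells : {ae lebesgue_rV R N, forall x, forall n i, (i <= n)%N ->
   \int[lebesgue_measure]_t (r (x, t) * cell (i%:R * (T / n.+1%:R)) (i.+1%:R * (T / n.+1%:R)) t)
      <= K * (T / n.+1%:R)}.
  apply/ae_foralln => n; apply/ae_foralln => i.
  have [i_n|i_n] := leqP i n; last first.
    by apply: aeW.
  have n0 : (0 < n.+1)%N by [].
  have in1 : (i.+1 <= n.+1)%N by [].
  have in2 : (0 < i.+1 <= n.+1)%N by [].
  have h0 : 0 < 1%:R * (T / n.+1%:R) by rewrite mul1r divr_gt0.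
  have t0 : 0 <= i.+1%:R * (T / n.+1%:R) by rewrite mulr_ge0// divr_ge0// ltW.
  have X0 := inside_eq0 mO s_ge0 T_gt0 Lr Ldr r_off Lf1 Lg1 Lv0 f1le g1le v0le Mf0 Mg0 M00 id
    n0 (ltn0Sn 0) in1.
  have Y0 := outside_eq0 mO s_ge0 T_gt0 Lr Ldr r_off Lf1 Lg1 Lv0 f1le g1le v0le Mf0 Mg0 M00 id
    n0 (ltn0Sn 0) in2.
  have [Hw _] := Hs_excess mO s_ge0 Lr Ldr Mf0 Mg0 M00 h0 t0.
  have [Lw _] := (HsP mO s_ge0 _).1 Hw.
  have aeX := ip_eq0 (L2_restrict mO Lw) X0.
  have aeY := ip_eq0 (L2_restrict (measurableC mO) Lw) Y0.
  apply: aeS (aeI aeX aeY) => x [wX wY] _.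
  have w0 : excess r Mf Mg M0 (1%:R * (T / n.+1%:R)) (i.+1%:R * (T / n.+1%:R)) x = 0.
    by move: wX wY; rewrite !patchE in_setC; case: (x \in Omega).
  set h := 1%:R * (T / n.+1%:R) in h0 w0 *; set tau := i.+1%:R * (T / n.+1%:R) in t0 w0 *.
  have hE : h = T / n.+1%:R by rewrite /h mul1r.
  have -> : i%:R * (T / n.+1%:R) = tau - h by rewrite /tau /h -[i.+1%:R]natr1 mulrDl addrK.
  have avK : average r h tau x <= K.
    have le1 : average r h tau x <= barrier Mf Mg M0 h tau.
      by rewrite -subr_le0; move: w0; rewrite /excess => <-; rewrite le_max lexx orbT.
    apply: le_trans le1 _; rewrite /barrier /K lerD2r; apply: lerD.
      by rewrite ler_piMr// ge_min lexx orbT.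
    apply: ler_wpM2l => //.
    by rewrite /tau mulrCA ger_pMr// ler_pdivrMr ?ltr0n// mul1r ler_nat.
  move: avK; rewrite /average mulrC ler_pdivrMr// -hE.
  exact.
have rK : {ae space_time R N, forall z : 'rV[R]_N * R, 0 < z.2 < T -> r z <= K}.
  apply: ae_space_time; first by case: Lr.
  apply: aeS cells => x xM; apply: le_of_cell_averages => //.
  have Lrx : L2 (@lebesgue_measure R) (fun t => r (x, t)) by case: Lr.
  have := L2_mul_integrable Lrx (L2_cell 0 T).
  rewrite (_ : (fun t => r (x, t) * cell 0 T t) = fun t => r (x, t))//.
  apply/funext => t; rewrite cellE.
  have [tT|tT] := boolP (t \in `]0, T[); last by rewrite r_off// mul0r.
  by move: tT; rewrite in_itv /= => /andP[/ltW -> ->]; rewrite mulr1.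
have rE' := ae_fst rE; have ends := @ae_neq_ends R N T.
have KM : K <= expR T * (M0 + Mf + Mg).
  have := expR_ge1Dx T; set e := expR T => eT; rewrite /K !mulrDr.
  have e1 : 1 <= e by apply: le_trans eT; rewrite lerDl ltW.
  have Te : T <= e by apply: le_trans eT; rewrite lerDr.
  apply: lerD; [apply: lerD|].
  - exact: ler_peMl.
  - by rewrite mulrC; exact: ler_wpM2r.
  - exact: ler_peMl.
have : {ae space_time R N, forall z : 'rV[R]_N * R, [/\ 0 < z.2 < T -> r z <= K,
   z.2 != 0 /\ z.2 != T & forall t, t \in `]0, T[ -> r (z.1, t) = rho (z.1, t)]}.
  by apply: aeS (aeI rK (aeI ends rE')) => z [h1 [h2 h3]]; split.
apply: aeS => -[x t] /= [rz [t0 tT] rr] tI.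
have t0T : t \in `]0, T[.
  move: tI; rewrite !in_itv /= => /andP[h1 h2].
  by rewrite !lt_neqAle h1 h2 eq_sym t0 tT.
rewrite -!EFinD -EFinM lee_fin; apply: le_trans KM.
by rewrite -rr//; apply: rz; move: t0T; rewrite in_itv.
Qed.
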